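(* Flinn's conjecture, which asserts that every weakly expansive continuous flow on a compact metric space is expansive, is false. That is, there exist a compact metric space $(M,d)$ and a continuous flow $\phi:\mathbb{R}\times M\to M$ such that $(\phi_t)_{t\in\mathbb{R}}$ is weakly expansive but not expansive.
   Context: Let $\phi:\mathbb{R}\times M\to M$ be a continuous flow on a compact metric space $(M,d)$. Expansive (in the sense of Flinn): $(\phi_t)_{t\in\mathbb{R}}$ is expansive if for each $\varepsilon>0$ there exists $\delta>0$ with the following property: if $x,y\in M$ and $s:\mathbb{R}\to\mathbb{R}$ is a homeomorphism with $s(0)=0$, $s(t)>0$ for $t>0$, and $d(\phi_t(x),\phi_{s(t)}(y))<\delta$ for all $t\in\mathbb{R}$, then $y=\phi_\tau(x)$ for some $\tau\in(-\varepsilon,\varepsilon)$. Kinematic expansive: $(\phi_t)_{t\in\mathbb{R}}$ is kinematic expansive if for each $\varepsilon>0$ there exists $\delta>0$ such that whenever $x,y\in M$ satisfy $d(\phi_t(x),\phi_t(y))<\delta$ for all $t\in\mathbb{R}$, then $y=\phi_\tau(x)$ for some $\tau\in(-\varepsilon,\varepsilon)$. Time change: for continuous flows $\phi,\psi:\mathbb{R}\times M\to M$, $(\phi_t)_{t\in\mathbb{R}}$ is a time change of $(\psi_t)_{t\in\mathbb{R}}$ if for every $x\in M$ the orbits $\phi_{\mathbb{R}}(x)$ and $\psi_{\mathbb{R}}(x)$ and their orientations coincide (the orbit through $x$ is the same set and is traversed in the same direction by both flows, i.e. for each $x$ there is an increasing homeomorphism $s_x:\mathbb{R}\to\mathbb{R}$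 with $s_x(0)=0$ and $\phi_t(x)=\psi_{s_x(t)}(x)$ for all $t$). Weakly expansive (equivalently, strong kinematic expansive): $(\phi_t)_{t\in\mathbb{R}}$ is weakly expansive if every time change of $(\phi_t)_{t\in\mathbb{R}}$ is kinematic expansive. *)

(* Defs.v *)
From HB Require Import structures.
From mathcomp Require Import all_boot all_order all_algebra.
From mathcomp Require Import all_classical all_reals all_analysis.

Set Implicit Arguments.
Unset Strict Implicit.
Unset Printing Implicit Defensive.

Import Order.TTheory GRing.Theory Num.Theory.
Import numFieldNormedType.Exports.

Local Open Scope classical_set_scope.
Local Open Scope ring_scope.

Definition homeomorphism (X Y : topologicalType) (f : X -> Y) : Prop :=
  continuous f /\
  exists g : Y -> X, [/\ cancel f g, cancel g f & continuous g].

Record continuous_flow (R : realType) (M : topologicalType)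
    (phi : R -> M -> M) : Prop := ContinuousFlow {
  flow_continuous : continuous (fun p : R * M => phi p.1 p.2);
  flow0 : forall x : M, phi 0 x = x;
  flowD : forall (s t : R) (x : M), phi (s + t) x = phi s (phi t x)
}.

(* Expansiveness in the sense of Flinn. *)
Definition expansive (R : realType) (M : metricType R)
    (phi : R -> M -> M) : Prop :=
  forall eps : R, 0 < eps ->
  exists2 delta : R, 0 < delta &
    forall (x y : M) (s : R -> R),
      homeomorphism s -> s 0 = 0 -> (forall t : R, 0 < t -> 0 < s t) ->
      (forall t : R, mdist (phi t x) (phi (s t) y) < delta) ->
      exists2 tau : R, - eps < tau < eps & y = phi tau x.

Definition kinematic_expansive (R : realType) (M : metricType R)
    (phi : R -> M -> M) : Prop :=
  forall eps : R, 0 < eps ->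
  exists2 delta : R, 0 < delta &
    forall x y : M,
      (forall t : R, mdist (phi t x) (phi t y) < delta) ->
      exists2 tau : R, - eps < tau < eps & y = phi tau x.

(* At a common fixed point any [s] will do, so the condition there only says
   that the two singleton orbits agree. *)
Definition time_change (R : realType) (M : topologicalType)
    (phi psi : R -> M -> M) : Prop :=
  forall x : M, exists s : R -> R,
    [/\ homeomorphism s, {homo s : t u / t < u}, s 0 = 0 &
        forall t : R, phi t x = psi (s t) x].

Definition weakly_expansive (R : realType) (M : metricType R)
    (phi : R -> M -> M) : Prop :=
  forall psi : R -> M -> M, continuous_flow psi -> time_change psi phi ->
    kinematic_expansive psi.

(* Main.v *)
Require Import Defs.
From HB Require Import structures.
From mathcomp Require Import all_boot all_order all_algebra.
From mathcomp Require Import all_classical all_reals all_analysis.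
From mathcomp Require Import zify ring lra.
Import Order.TTheory GRing.Theory Num.Theory.
Import numFieldNormedType.Exports.
Local Open Scope classical_set_scope.
Local Open Scope ring_scope.

Set Implicit Arguments.
Unset Strict Implicit.
Unset Printing Implicit Defensive.

(* The flow is the linear flow of slope [sqrt 2] on the torus, slowed down so
   that one point [rest] becomes fixed.

   Two vertical translates of a leaf that miss [rest] stay at constant
   distance from each other and can be matched by a reparametrization, so the
   flow is not expansive.

   Conversely, let [psi] be a time change and suppose that [psi t x] and
   [psi t y] stay close, at equal times.  The orbit of [x] comes arbitrarily close to
   [rest], where [psi] stays for arbitrarily long times; meanwhile [psi t y] has
   to wait near [rest] too, since every orbit other than [rest] gets far away
   from it.  Hence the two orbits approach [rest] simultaneously, and so their
   transverse distance, which is constant, vanishes: [y] lies on the leaf of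
   [x], and compactness away from [rest] makes the time shift small. *)

(** * Euler polygons and the flow of a Lipschitz vector field on the line *)

(** Each leaf is parametrized by the line, where the slowed flow is that of a Lipschitz scalar
    field, the distance to [rest]. This flow is built as a limit of Euler polygons; their explicit
    error bounds also give continuity from one leaf to the next.

    A time change may run along an orbit at any pace, so no estimate on speeds survives. What does
    survive is the order along the leaf and the stretch of it that is swept ([is_progress]); the
    long stay near [rest] comes only from continuity of [psi T] at the fixed point.

    Slowing has a price: the leaf through [rest] breaks into the fixed point and two half-leaves, so
    a point on the leaf of [x] could lie beyond [rest] and thus on another orbit.
    [same_leaf_same_orbit] excludes this by following the end of the leaf that [x] still sweeps
    entirely. *)

Lemma continuous_IVT {R : realType} (f : R -> R) (s t c : R) :
  continuous f -> f s <= c <= f t -> exists r, f r = c.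
Proof.
move=> fc /andP[sc ct].
have [st|/ltW ts] := leP s t.
  have [||r _ <-] := @IVT R f s t c st; last by exists r.
    exact: continuous_subspaceT.
  by rewrite ge_min sc le_max ct orbT.
have [||r _ <-] := @IVT R f t s c ts; last by exists r.
  exact: continuous_subspaceT.
by rewrite ge_min sc orbT le_max ct.
Qed.

Section Iteration.
Context {R : realType}.
Implicit Types (f g : R -> R) (q e : R) (N : nat).

(** A discrete Gronwall estimate: each defect [e] is amplified by at most [q ^+ N], which replaces
    the geometric sum because [1 <= q]. *)
Lemma iter_close f g q e N : 1 <= q -> 0 <= e ->
  (forall x y, `|f x - f y| <= q * `|x - y|) ->
  (forall x, `|f x - g x| <= e) ->
  forall x y, `|iter N f x - iter N g y| <= q ^+ N * (`|x - y| + N%:R * e).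
Proof.
move=> q1 e0 fq fge x y; elim: N => [|N IH] /=.
  by rewrite expr0 mul1r mul0r addr0.
set a := iter N f x in IH *; set b := iter N g y in IH *.
have H1 : `|f a - g b| <= `|f a - f b| + `|f b - g b|.
  by rewrite (le_trans _ (ler_normD _ _))// addrA subrK.
have H2 := fq a b; have H3 := fge b.
have q0 : 0 <= q by apply: le_trans q1.
have H4 : q * `|a - b| <= q * (q ^+ N * (`|x - y| + N%:R * e)).
  by rewrite ler_wpM2l.
have H5 : e <= q ^+ N.+1 * e by rewrite ler_peMl// exprn_ege1.
rewrite -natr1 mulrDl mul1r addrA mulrDr exprS -mulrA -exprS; lra.
Qed.

(** Peel off the innermost pair [g (f y)]: its defect [e] is amplified by the [N] outer copies of
    [g]. The use is for Euler steps run forwards by [f] and backwards by [g]. *)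
Lemma iter_cancel f g q e N : 1 <= q -> 0 <= e ->
  (forall x y, `|g x - g y| <= q * `|x - y|) ->
  (forall x, `|g (f x) - x| <= e) ->
  forall x, `|iter N g (iter N f x) - x| <= q ^+ N * (N%:R * e).
Proof.
move=> q1 e0 gq gfe x; elim: N => [|N IH] /=.
  by rewrite subrr normr0 mul0r mulr0.
rewrite -iterS iterSr; set y := iter N f x in IH *.
have H1 : `|iter N g (g (f y)) - iter N g y| <= q ^+ N * (e + N%:R * 0).
  apply: (le_trans (iter_close N q1 (lexx 0) gq _ _ _)).
    by move=> z; rewrite subrr normr0.
  by rewrite ler_wpM2l ?exprn_ge0 ?(le_trans _ q1)// lerD2r gfe.
have H2 : `|iter N g (g (f y)) - x| <=
    `|iter N g (g (f y)) - iter N g y| + `|iter N g y - x|.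
  by rewrite (le_trans _ (ler_normD _ _))// addrA subrK.
have q0 : 0 <= q by apply: le_trans q1.
have H3 : q ^+ N * ((N.+1)%:R * e) <= q ^+ N.+1 * ((N.+1)%:R * e).
  by rewrite exprS -mulrA ler_peMl// !mulr_ge0// exprn_ge0.
by move: H1 H2 H3 IH; rewrite mulr0 addr0 -natr1 !mulrDl !mul1r !mulrDr; lra.
Qed.

(** Shifting the sequence by [2 * C / 2 ^+ n] down or up makes it monotone, since the shift shrinks
    by at least the size of a jump; the limit is squeezed between the two shifted sequences. *)
Lemma dyadic_cvg (x : R^nat) C :
  (forall n, `|x n.+1 - x n| <= C / 2 ^+ n) ->
  forall n, `|limn x - x n| <= 2 * C / 2 ^+ n.
Proof.
move=> xC n.
have V k : (2 : R) ^- k.+1 = 2 ^- k / 2 by rewrite exprSr invfM.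
have P k : 0 <= (2 : R) ^- k by rewrite invr_ge0 exprn_ge0.
have C0 : 0 <= C by have := le_trans (normr_ge0 _) (xC 0%N); rewrite expr0 divr1.
have CP k : 0 <= C * 2 ^- k by rewrite mulr_ge0.
pose lo k := x k - 2 * C * 2 ^- k; pose hi k := x k + 2 * C * 2 ^- k.
have lonD : {homo lo : k m / (k <= m)%N >-> k <= m}.
  apply/nondecreasing_seqP => k; rewrite /lo V.
  by have := xC k; rewrite ler_norml => /andP[]; lra.
have hinD : {homo hi : k m / (k <= m)%N >-> m <= k}.
  apply/nonincreasing_seqP => k; rewrite /hi V.
  by have := xC k; rewrite ler_norml => /andP[]; lra.
have lohi k m : lo k <= hi m.
  have [km|mk] := leqP k m.
    by apply: le_trans (lonD _ _ km) _; rewrite /lo /hi; have := CP m; lra.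
  by apply: le_trans _ (hinD _ _ (ltnW mk)); rewrite /lo /hi; have := CP k; lra.
have clo : cvgn lo.
  by apply: nondecreasing_is_cvgn => //; exists (hi 0%N) => _ [k _ <-].
have c2 : (fun k => 2 * C * 2 ^- k) @ \oo --> 0.
  rewrite -(mulr0 (2 * C)); apply: cvgMr => //.
  have := @cvg_expr R 2^-1; rewrite ger0_norm ?invr_ge0// => /(_ _).
  under eq_fun do rewrite -exprVn; apply; lra.
have cx : x @ \oo --> limn lo.
  have -> : x = lo \+ (fun k => 2 * C * 2 ^- k).
    by apply/funext => k /=; rewrite /lo subrK.
  by rewrite -[X in _ --> X]addr0; apply: cvgD.
have xlo : limn x = limn lo by apply: cvg_lim.
rewrite xlo ler_distl; apply/andP; split.
  apply: limr_ge => //; near=> k.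
  by have := lonD n k; rewrite {1}/lo; apply; near: k; exact: nbhs_infty_ge.
apply: limr_le => //; near=> k; have := lohi k n; rewrite /hi; lra.
Unshelve. all: by end_near.
Qed.

End Iteration.

Section LipschitzODE.
Context {R : realType}.
Implicit Types (F G : R -> R) (L B t s u w h e : R) (n k N : nat).

Definition lipschitz_bounded L B F : Prop :=
  [/\ 0 <= L, 0 <= B, forall u w, `|F u - F w| <= L * `|u - w| &
      forall u, `|F u| <= B].

Definition euler_step F h u : R := u + h * F u.

(** Dyadic steps make the successive grids nested; the final time is rounded down to the grid, which
    costs at most one step. *)
Definition euler F n t u : R :=
  iter (Num.truncn (t * 2 ^+ n)) (euler_step F (2 ^- n)) u.

Definition semiflow F t u : R := limn (fun n => euler F n t u).

Definition ode_flow F t u : R :=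
  if 0 <= t then semiflow F t u else semiflow (fun w => - F w) (- t) u.

Lemma lipschitz_boundedN L B F :
  lipschitz_bounded L B F -> lipschitz_bounded L B (fun u => - F u).
Proof.
move=> [L0 B0 FL FB]; split=> // u => [w|]; last by rewrite normrN.
by rewrite -opprD normrN.
Qed.

Lemma euler_step_lip L B F h u w : lipschitz_bounded L B F -> 0 <= h ->
  `|euler_step F h u - euler_step F h w| <= (1 + L * h) * `|u - w|.
Proof.
move=> [L0 B0 FL FB] h0; rewrite /euler_step.
have -> : u + h * F u - (w + h * F w) = (u - w) + h * (F u - F w) by ring.
rewrite (le_trans (ler_normD _ _))// normrM (ger0_norm h0) mulrDl mul1r lerD2l.
by rewrite [L * h]mulrC -mulrA ler_wpM2l.
Qed.

Lemma euler_growth L N h t : 0 <= L -> 0 <= h -> N%:R * h <= t ->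
  (1 + L * h) ^+ N <= expR (L * t).
Proof.
move=> L0 h0 Nht; apply: (@le_trans _ _ (expR (L * h) ^+ N)).
  by rewrite lerXn2r ?nnegrE ?expR_ge0 ?expR_ge1Dx// addr_ge0// mulr_ge0.
by rewrite -expRM_natl ler_expR mulrCA ler_wpM2l.
Qed.

Lemma truncn_dyadic t n : 0 <= t -> (Num.truncn (t * 2 ^+ n))%:R * 2 ^- n <= t.
Proof.
move=> t0; rewrite ler_pdivrMr ?exprn_gt0//.
by rewrite truncn_le mulr_ge0// exprn_ge0.
Qed.

Lemma dyadic_ge0 n : 0 <= (2 : R) ^- n. Proof. by rewrite invr_ge0 exprn_ge0. Qed.

(** Two half steps differ from one full step only by where the second one samples [F], an error
    quadratic in the step. Summed over the steps this is linear in the step, as is the possible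
    extra half step at the end. *)
Lemma euler_succ L B F n t u : lipschitz_bounded L B F -> 0 <= t ->
  `|euler F n.+1 t u - euler F n t u| <=
  (B + expR (L * t) * t * L * B) / 2 ^+ n.
Proof.
move=> FLB t0; have [L0 B0 FL FB] := FLB.
rewrite /euler; set N := Num.truncn (t * 2 ^+ n); set N' := Num.truncn _.
set h := 2 ^- n.+1; have h0 : 0 <= h by exact: dyadic_ge0.
have hE : 2 ^- n = h + h.
  by rewrite /h exprSr invfM -mulrDr -[LHS]mulr1; congr (_ * _); lra.
(* Rounding down on the finer grid may gain one half step. *)
have NN : N' = (N * 2)%N \/ N' = (N * 2).+1.
  have t2 k : 0 <= t * 2 ^+ k by rewrite mulr_ge0// exprn_ge0.
  have /andP[a1 a2] := truncn_itv (t2 n); have /andP[b1 b2] := truncn_itv (t2 n.+1).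
  rewrite -/N in a1 a2; rewrite -/N' exprSr mulrA in b1 b2.
  have c1 : (N * 2 < N'.+1)%N by rewrite -(ltr_nat R) natrM; lra.
  have c2 : (N' < N.+1 * 2)%N by rewrite -(ltr_nat R) natrM; lra.
  by move: (N) (N') c1 c2 => i j; clear; lia.
set f := euler_step F h; set g := euler_step F _.
have Nt : N%:R * (h + h) <= t by rewrite -hE; exact: truncn_dyadic.
have C0 : `|iter (N * 2) f u - iter N g u| <=
    expR (L * t) * (N%:R * (h * L * h * B)).
  rewrite iterM.
  have q1 : 1 <= (1 + L * h) ^+ 2 by rewrite exprn_ege1// lerDl mulr_ge0.
  have e0 : 0 <= h * L * h * B by rewrite !mulr_ge0.
  apply: le_trans (@iter_close R (iter 2 f) g _ _ N q1 e0 _ _ u u) _.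
  - move=> x y /=; rewrite expr2 -mulrA.
    apply: le_trans (euler_step_lip _ _ FLB h0) _.
    by rewrite ler_wpM2l ?addr_ge0 ?mulr_ge0//; exact: euler_step_lip FLB h0.
  - move=> x /=; rewrite /f /g /euler_step hE.
    set y := x + h * F x.
    have -> : y + h * F y - (x + (h + h) * F x) = h * (F y - F x) by rewrite /y; ring.
    rewrite normrM (ger0_norm h0) -!mulrA ler_wpM2l//.
    apply: le_trans (FL _ _) _; rewrite ler_wpM2l//.
    by rewrite /y addrAC subrr add0r normrM ger0_norm// ler_wpM2l.
  rewrite subrr normr0 add0r ler_wpM2r ?mulr_ge0// -exprM.
  by apply: euler_growth => //; rewrite natrM; lra.
have C1 : `|iter N' f u - iter (N * 2) f u| <= h * B.
  case: NN => ->; first by rewrite subrr normr0 mulr_ge0.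
  rewrite /= {1}/f /euler_step addrAC subrr add0r normrM ger0_norm//.
  by rewrite ler_wpM2l.
have C2 : N%:R * (h * L * h * B) <= h * (t * L * B).
  have -> : N%:R * (h * L * h * B) = (N%:R * h) * (h * L * B) by ring.
  have -> : h * (t * L * B) = t * (h * L * B) by ring.
  by rewrite ler_wpM2r ?mulr_ge0//; have : 0 <= N%:R * h by [rewrite mulr_ge0]; lra.
have C3 := ler_wpM2l (expR_ge0 (L * t)) C2.
apply: (@le_trans _ _ (`|iter N' f u - iter (N * 2) f u| +
  `|iter (N * 2) f u - iter N g u|)).
  by rewrite (le_trans _ (ler_normD _ _))// addrA subrK.
rewrite hE.
have C4 : 0 <= h * B by rewrite mulr_ge0.
have C5 : 0 <= h * (t * L * B) by rewrite !mulr_ge0.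
have := mulr_ge0 (expR_ge0 (L * t)) C5; lra.
Qed.

Lemma semiflow_approx L B F n t u : lipschitz_bounded L B F -> 0 <= t ->
  `|semiflow F t u - euler F n t u| <=
  2 * (B + expR (L * t) * t * L * B) / 2 ^+ n.
Proof.
move=> FLB t0; apply: (@dyadic_cvg R (fun n => euler F n t u)) => k.
exact: euler_succ.
Qed.

(** The passage to the limit: the properties of [semiflow] below are proved for polygons up to an
    error [C / 2 ^+ n] and then freed of it. *)
Lemma dyadic_le0 (a C : R) : (forall n, a <= C / 2 ^+ n) -> a <= 0.
Proof.
move=> aC; rewrite leNgt; apply/negP => a0.
have := @upper_nthrootP R (C / a) _ (leqnn _); set n := Num.bound _.
rewrite ltr_pdivrMr// => H.
have := aC n; rewrite leNgt ltr_pdivrMr ?exprn_gt0// mulrC H//.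
Qed.

Lemma euler_lip L B F n t u w : lipschitz_bounded L B F -> 0 <= t ->
  `|euler F n t u - euler F n t w| <= expR (L * t) * `|u - w|.
Proof.
move=> FLB t0; have [L0 B0 FL FB] := FLB; rewrite /euler.
have h0 := dyadic_ge0 n; set N := Num.truncn _; set f := euler_step F _.
have q1 : 1 <= 1 + L * 2 ^- n by rewrite lerDl mulr_ge0.
have fq x y := euler_step_lip x y FLB h0.
apply: le_trans (iter_close N q1 (lexx 0) fq _ u w) _.
  by move=> x; rewrite subrr normr0.
rewrite mulr0 addr0 ler_wpM2r// euler_growth//; exact: truncn_dyadic.
Qed.

Lemma semiflow_lip L B F t u w : lipschitz_bounded L B F -> 0 <= t ->
  `|semiflow F t u - semiflow F t w| <= expR (L * t) * `|u - w|.
Proof.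
move=> FLB t0; rewrite -subr_le0; set C := 2 * (B + expR (L * t) * t * L * B).
apply: (@dyadic_le0 _ (2 * C)) => n.
have := semiflow_approx n u FLB t0; have := semiflow_approx n w FLB t0.
have := euler_lip n u w FLB t0; rewrite -/C.
set a := semiflow _ _ u; set b := semiflow _ _ w.
set a' := euler _ _ _ u; set b' := euler _ _ _ w.
rewrite -mulrA; set Cn := C / _ => H1 H2 H3.
have -> : a - b = (a - a') + ((a' - b') - (b - b')) by ring.
have := ler_normD (a - a') ((a' - b') - (b - b')).
have := ler_normB (a' - b') (b - b'); lra.
Qed.

(** Continuous dependence on the field; neighbouring leaves carry uniformly close fields. *)
Lemma semiflow_lip_field L B F G e t u : lipschitz_bounded L B F ->
  lipschitz_bounded L B G -> 0 <= t -> (forall w, `|F w - G w| <= e) ->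
  `|semiflow F t u - semiflow G t u| <= expR (L * t) * (t * e).
Proof.
move=> FLB GLB t0 FGe; have [L0 B0 FL FB] := FLB.
have e0 : 0 <= e := le_trans (normr_ge0 _) (FGe 0).
rewrite -subr_le0; set C := 2 * (B + expR (L * t) * t * L * B).
apply: (@dyadic_le0 _ (2 * C)) => n.
have := semiflow_approx n u FLB t0; have := semiflow_approx n u GLB t0.
have : `|euler F n t u - euler G n t u| <= expR (L * t) * (t * e).
  rewrite /euler; have h0 := dyadic_ge0 n; set N := Num.truncn _.
  have q1 : 1 <= 1 + L * 2 ^- n by rewrite lerDl mulr_ge0.
  have fq x y := euler_step_lip x y FLB h0.
  have e'0 : 0 <= 2 ^- n * e by rewrite mulr_ge0.
  apply: le_trans (iter_close N q1 e'0 fq _ u u) _.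
    move=> x; rewrite /euler_step opprD addrACA subrr add0r -mulrBr normrM.
    by rewrite (ger0_norm h0) ler_wpM2l.
  rewrite subrr normr0 add0r [N%:R * _]mulrA; apply: ler_pM.
  - by rewrite exprn_ge0// addr_ge0// mulr_ge0.
  - by rewrite !mulr_ge0.
  - by apply: euler_growth => //; exact: truncn_dyadic.
  - by rewrite ler_wpM2r//; exact: truncn_dyadic.
rewrite -/C.
set a := semiflow F _ u; set b := semiflow G _ u.
set a' := euler F _ _ u; set b' := euler G _ _ u.
rewrite -mulrA; set Cn := C / _ => H1 H2 H3.
have -> : a - b = (a - a') + ((a' - b') - (b - b')) by ring.
have := ler_normD (a - a') ((a' - b') - (b - b')).
have := ler_normB (a' - b') (b - b'); lra.
Qed.

Lemma semiflowD L B F s t u : lipschitz_bounded L B F -> 0 <= s -> 0 <= t ->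
  semiflow F (s + t) u = semiflow F s (semiflow F t u).
Proof.
move=> FLB s0 t0; have [L0 B0 FL FB] := FLB.
apply/eqP; rewrite -subr_eq0 -normr_le0.
set D := 2 * (B + expR (L * (s + t)) * (s + t) * L * B).
set C := 2 * (B + expR (L * t) * t * L * B).
set E := 2 * (B + expR (L * s) * s * L * B).
apply: (@dyadic_le0 _ (D + B + expR (L * s) * C + E)) => n.
have H1 := semiflow_approx n u FLB (addr_ge0 s0 t0).
have H2 := semiflow_approx n u FLB t0.
have H3 := semiflow_approx n (semiflow F t u) FLB s0.
have H4 := euler_lip n (euler F n t u) (semiflow F t u) FLB s0.
(* Rounding [s] and [t] separately loses at most one step against rounding [s + t]. *)
have H5 : `|euler F n (s + t) u - euler F n s (euler F n t u)| <= B / 2 ^+ n.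
  rewrite /euler -iterD; set f := euler_step F _.
  set Ns := Num.truncn (s * _); set Nt := Num.truncn (t * _).
  set N := Num.truncn _.
  have P (r : R) : 0 <= r -> 0 <= r * 2 ^+ n by move=> ?; rewrite mulr_ge0// exprn_ge0.
  have /andP[a1 a2] := truncn_itv (P _ s0); have /andP[b1 b2] := truncn_itv (P _ t0).
  have /andP[] := truncn_itv (P _ (addr_ge0 s0 t0)).
  rewrite -/N mulrDl => c1 c2; rewrite -/Ns in a1 a2; rewrite -/Nt in b1 b2.
  have d1 : (Ns + Nt < N.+1)%N by rewrite -(ltr_nat R) natrD; lra.
  have d2 : (N < (Ns + Nt).+2)%N.
    rewrite -addSn -addnS -(ltr_nat R) natrD; lra.
  have [->|->] : N = (Ns + Nt)%N \/ N = (Ns + Nt).+1.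
    by move: (N) (Ns) (Nt) d1 d2 => i j k; clear; lia.
    by rewrite subrr normr0 mulr_ge0// dyadic_ge0.
  rewrite /= {1}/f /euler_step addrAC subrr add0r normrM ger0_norm ?dyadic_ge0//.
  by rewrite mulrC ler_wpM2r// dyadic_ge0.
rewrite -/D in H1; rewrite -/C in H2; rewrite -/E in H3.
have H6 : expR (L * s) * `|euler F n t u - semiflow F t u| <=
    expR (L * s) * (C / 2 ^+ n).
  by rewrite ler_wpM2l ?expR_ge0// distrC.
rewrite !mulrDl -mulrA.
set a := semiflow F (s + t) u in H1 *; set b := semiflow F s _ in H3 *.
set a' := euler F n (s + t) u in H1 H5 *.
set b1 := euler F n s (euler F n t u) in H4 H5 *.
set b2 := euler F n s (semiflow F t u) in H3 H4 *.
have -> : a - b = ((a - a') + (a' - b1)) + ((b1 - b2) - (b - b2)) by ring.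
have := ler_normD ((a - a') + (a' - b1)) ((b1 - b2) - (b - b2)).
have := ler_normD (a - a') (a' - b1).
have := ler_normB (b1 - b2) (b - b2); lra.
Qed.

(** A step along [- F] undoes a step along [F] up to a quadratic error, so backward polygons nearly
    invert forward ones. *)
Lemma semiflowK L B F t u : lipschitz_bounded L B F -> 0 <= t ->
  semiflow (fun w => - F w) t (semiflow F t u) = u.
Proof.
move=> FLB t0; have [L0 B0 FL FB] := FLB.
have GLB := lipschitz_boundedN FLB; set G := fun w => _ in GLB *.
apply/eqP; rewrite -subr_eq0 -normr_le0.
set C := 2 * (B + expR (L * t) * t * L * B).
apply: (@dyadic_le0 _ (C + expR (L * t) * C + expR (L * t) * (t * L * B))) => n.
have H1 := semiflow_approx n u FLB t0.
have H2 := semiflow_approx n (semiflow F t u) GLB t0.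
have H3 := euler_lip n (semiflow F t u) (euler F n t u) GLB t0.
have H4 : `|euler G n t (euler F n t u) - u| <= expR (L * t) * (t * L * B) / 2 ^+ n.
  rewrite /euler; set N := Num.truncn _; have h0 := dyadic_ge0 n.
  set h := 2 ^- n in h0 *.
  have q1 : 1 <= 1 + L * h by rewrite lerDl mulr_ge0.
  have fq x y := euler_step_lip x y GLB h0.
  have e0 : 0 <= h * L * h * B by rewrite !mulr_ge0.
  have Nt : N%:R * h <= t by exact: truncn_dyadic.
  apply: le_trans (@iter_cancel R (euler_step F h) _ _ _ N q1 e0 fq _ u) _.
    move=> x; rewrite /euler_step /G; set y := x + h * F x.
    have -> : y + h * - F y - x = h * (F x - F y) by rewrite /y; ring.
    rewrite normrM (ger0_norm h0) -!mulrA ler_wpM2l//.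
    apply: le_trans (FL _ _) _; rewrite ler_wpM2l//.
    by rewrite /y opprD addrA subrr add0r normrN normrM ger0_norm// ler_wpM2l.
  rewrite -[leRHS]mulrA; apply: ler_pM.
  - by rewrite exprn_ge0// addr_ge0// mulr_ge0.
  - by rewrite mulr_ge0.
  - exact: euler_growth.
  - have -> : N%:R * (h * L * h * B) = (N%:R * h) * (L * B * h) by ring.
    have -> : t * L * B / 2 ^+ n = t * (L * B * h) by rewrite /h; ring.
    by rewrite ler_wpM2r// !mulr_ge0.
rewrite -/C in H1 H2.
have H6 := ler_wpM2l (expR_ge0 (L * t)) H1.
set a := semiflow G _ _ in H2 *.
set b1 := euler G n t _ in H2 H3; set b2 := euler G n t _ in H3 H4.
have -> : a - u = ((a - b1) + (b1 - b2)) + (b2 - u) by ring.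
have := ler_normD ((a - b1) + (b1 - b2)) (b2 - u).
have := ler_normD (a - b1) (b1 - b2).
rewrite !mulrDl -!mulrA in H1 H2 H3 H4 H6 *; lra.
Qed.

(** This bound takes the place of the differential equation: it is the only link from the motion
    back to the value of the field. *)
Lemma semiflow_tangent L B F t u : lipschitz_bounded L B F -> 0 <= t ->
  `|semiflow F t u - u - t * F u| <= L * B * t ^+ 2.
Proof.
move=> FLB t0; have [L0 B0 FL FB] := FLB.
rewrite -subr_le0; set C := 2 * (B + expR (L * t) * t * L * B).
apply: (@dyadic_le0 _ (C + B)) => n.
have H1 := semiflow_approx n u FLB t0; rewrite -/C in H1.
have h0 := dyadic_ge0 n; set h := 2 ^- n in h0 *.
have I1 k : `|iter k (euler_step F h) u - u| <= k%:R * h * B.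
  elim: k => [|k IH] /=; first by rewrite subrr normr0 !mul0r.
  rewrite /euler_step addrAC (le_trans (ler_normD _ _))// -natr1 !mulrDl.
  by rewrite lerD// mul1r normrM ger0_norm// ler_wpM2l.
have I2 k : `|iter k (euler_step F h) u - u - k%:R * h * F u| <=
    L * B * (k%:R * h) ^+ 2.
  elim: k => [|k IH] /=; first by rewrite subrr !mul0r subr0 normr0 expr0n mulr0.
  rewrite {1}/euler_step; set y := iter k _ u in IH *.
  have -> : y + h * F y - u - k.+1%:R * h * F u =
      (y - u - k%:R * h * F u) + h * (F y - F u) by rewrite -natr1; ring.
  rewrite (le_trans (ler_normD _ _))// normrM (ger0_norm h0).
  have J1 : h * `|F y - F u| <= h * (L * (k%:R * h * B)).
    by rewrite ler_wpM2l// (le_trans (FL _ _))// ler_wpM2l//; exact: I1.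
  have -> : L * B * (k.+1%:R * h) ^+ 2 = L * B * (k%:R * h) ^+ 2 +
      2 * (h * (L * (k%:R * h * B))) + L * B * h ^+ 2 by rewrite -natr1; ring.
  have J2 : 0 <= L * B * h ^+ 2 by rewrite !mulr_ge0// exprn_ge0.
  have J3 : 0 <= h * (L * (k%:R * h * B)) by rewrite !mulr_ge0.
  lra.
have := I2 (Num.truncn (t * 2 ^+ n)); rewrite -/(euler F n t u).
set N := Num.truncn _ => H2.
have Nt : N%:R * h <= t := truncn_dyadic n t0.
have tN : t - N%:R * h <= h.
  have /andP[_] : N%:R <= t * 2 ^+ n < N.+1%:R.
    by apply: truncn_itv; rewrite mulr_ge0// exprn_ge0.
  by rewrite -ltr_pdivlMr ?exprn_gt0// -natr1 mulrDl mul1r -/h; lra.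
have H3 : L * B * (N%:R * h) ^+ 2 <= L * B * t ^+ 2.
  by rewrite ler_wpM2l ?mulr_ge0// lerXn2r ?nnegrE ?mulr_ge0.
have H4 : `|(N%:R * h - t) * F u| <= h * B.
  by rewrite normrM ler_pM// distrC ger0_norm; lra.
set a := semiflow F t u in H1 *; set b := euler F n t u in H1 H2 *.
have -> : a - u - t * F u =
  (a - b) + ((b - u - N%:R * h * F u) + (N%:R * h - t) * F u) by ring.
have := ler_normD (a - b) ((b - u - N%:R * h * F u) + (N%:R * h - t) * F u).
have := ler_normD (b - u - N%:R * h * F u) ((N%:R * h - t) * F u).
rewrite -/h in H1 *; move=> H5 H6; rewrite [leRHS]mulrDl; lra.
Qed.

Lemma semiflow_ge L B F t u : lipschitz_bounded L B F -> 0 <= t ->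
  (forall w, 0 <= F w) -> u <= semiflow F t u.
Proof.
move=> FLB t0 F0; rewrite -subr_le0.
apply: (@dyadic_le0 _ (2 * (B + expR (L * t) * t * L * B))) => n.
have := semiflow_approx n u FLB t0; rewrite ler_norml => /andP[+ _].
have : u <= euler F n t u; last by lra.
rewrite /euler; elim: (Num.truncn _) => //= k IH.
by rewrite (le_trans IH)// lerDl mulr_ge0// dyadic_ge0.
Qed.

Lemma semiflow_zero F t u : F u = 0 -> semiflow F t u = u.
Proof.
move=> Fu; rewrite /semiflow.
have -> : (fun n => euler F n t u) = (fun=> u); last exact: lim_cst.
apply/funext => n; rewrite /euler; elim: (Num.truncn _) => //= k ->.
by rewrite /euler_step Fu mulr0 addr0.
Qed.

Lemma semiflow_shift L B F a t u : lipschitz_bounded L B F -> 0 <= t ->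
  a + semiflow (fun w => F (a + w)) t u = semiflow F t (a + u).
Proof.
move=> FLB t0; have [L0 B0 FL FB] := FLB.
have GLB : lipschitz_bounded L B (fun w => F (a + w)).
  split=> // x w; apply: le_trans (FL _ _) _.
  by rewrite opprD addrACA subrr add0r.
apply/eqP; rewrite -subr_eq0 -normr_le0.
set C := 2 * (B + expR (L * t) * t * L * B).
apply: (@dyadic_le0 _ (2 * C)) => n.
have := semiflow_approx n (a + u) FLB t0; have := semiflow_approx n u GLB t0.
have -> : euler F n t (a + u) = a + euler (fun w => F (a + w)) n t u.
  rewrite /euler; elim: (Num.truncn _) => //= k ->.
  by rewrite {1}/euler_step addrA.
rewrite -/C -mulrA.
set x := semiflow _ _ _; set y := semiflow _ _ _; set z := euler _ _ _ _.
move=> H1 H2; have -> : a + x - y = (x - z) - (y - (a + z)) by ring.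
by have := ler_normB (x - z) (y - (a + z)); lra.
Qed.

End LipschitzODE.

Section LipschitzFlow.
Context {R : realType}.
Implicit Types (F G : R -> R) (L B t s u w h e : R).

Lemma semiflow0 F u : semiflow F 0 u = u.
Proof.
rewrite /semiflow; have -> : (fun n => euler F n 0 u) = (fun=> u).
  by apply/funext => n; rewrite /euler mul0r truncn0.
exact: lim_cst.
Qed.

Lemma semiflow_bound L B F t u : lipschitz_bounded L B F -> 0 <= t ->
  `|semiflow F t u - u| <= B * t.
Proof.
move=> FLB t0; have [L0 B0 FL FB] := FLB.
rewrite -subr_le0; set C := 2 * (B + expR (L * t) * t * L * B).
apply: (@dyadic_le0 _ _ C) => n.
have H1 := semiflow_approx n u FLB t0; rewrite -/C in H1.
have H2 : `|euler F n t u - u| <= B * t.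
  have h0 := dyadic_ge0 (R := R) n; rewrite mulrC.
  apply: le_trans (ler_wpM2r B0 (truncn_dyadic n t0)).
  rewrite /euler; elim: (Num.truncn _) => [|k IH] /=.
    by rewrite subrr normr0 !mul0r.
  rewrite {1}/euler_step addrAC (le_trans (ler_normD _ _))// -[k.+1%:R]natr1 !mulrDl.
  by rewrite lerD// mul1r normrM ger0_norm// ler_wpM2l.
have := ler_normD (semiflow F t u - euler F n t u) (euler F n t u - u).
by rewrite addrA subrK; lra.
Qed.

Lemma ode_flow_ge F t u : 0 <= t -> ode_flow F t u = semiflow F t u.
Proof. by rewrite /ode_flow => ->. Qed.

Lemma ode_flow_le F t u : t <= 0 ->
  ode_flow F t u = semiflow (fun w => - F w) (- t) u.
Proof.
rewrite /ode_flow le_eqVlt => /predU1P[->|/lt_geF ->]//.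
by rewrite lexx oppr0 !semiflow0.
Qed.

Lemma ode_flow0 F u : ode_flow F 0 u = u.
Proof. by rewrite ode_flow_ge// semiflow0. Qed.

Lemma semiflowNK L B F t u : lipschitz_bounded L B F -> 0 <= t ->
  semiflow F t (semiflow (fun w => - F w) t u) = u.
Proof.
move=> FLB t0; have := semiflowK u (lipschitz_boundedN FLB) t0.
by under eq_fun do rewrite opprK.
Qed.

(** When the signs of [s] and [t] differ, the longer time is split so that a part of it cancels the
    shorter one. *)
Lemma ode_flowD L B F s t u : lipschitz_bounded L B F ->
  ode_flow F (s + t) u = ode_flow F s (ode_flow F t u).
Proof.
move=> FLB; have GLB := lipschitz_boundedN FLB.
have [s0|/ltW s0] := leP 0 s; have [t0|/ltW t0] := leP 0 t.
- by rewrite !ode_flow_ge ?addr_ge0// (semiflowD _ FLB).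
- rewrite (ode_flow_ge _ _ s0) (ode_flow_le _ _ t0).
  have t'0 : 0 <= - t by rewrite oppr_ge0.
  have [st|/ltW st] := leP 0 (s + t).
    have E : s = (s + t) + - t by rewrite addrK.
    by rewrite ode_flow_ge// [in RHS]E (semiflowD _ FLB st t'0) (semiflowNK _ FLB).
  have E : - t = s + - (s + t) by rewrite opprD addrA subrr add0r.
  have st' : 0 <= - (s + t) by rewrite oppr_ge0.
  by rewrite ode_flow_le// [in RHS]E (semiflowD _ GLB s0 st') (semiflowNK _ FLB).
- rewrite (ode_flow_le _ _ s0) (ode_flow_ge _ _ t0).
  have s'0 : 0 <= - s by rewrite oppr_ge0.
  have [st|/ltW st] := leP 0 (s + t).
    have E : t = - s + (s + t) by rewrite addKr.
    by rewrite ode_flow_ge// [in RHS]E (semiflowD _ FLB s'0 st) (semiflowK _ FLB).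
  have E : - s = - (s + t) + t by rewrite opprD subrK.
  have st' : 0 <= - (s + t) by rewrite oppr_ge0.
  by rewrite ode_flow_le// [in RHS]E (semiflowD _ GLB st' t0) (semiflowK _ FLB).
- have st : s + t <= 0 by lra.
  by rewrite !ode_flow_le// opprD (semiflowD _ GLB) ?oppr_ge0.
Qed.

Lemma ode_flowK L B F t u : lipschitz_bounded L B F ->
  ode_flow F (- t) (ode_flow F t u) = u.
Proof. by move=> FLB; rewrite -(ode_flowD _ _ _ FLB) addNr ode_flow0. Qed.

Lemma ode_flow_lip L B F t u w : lipschitz_bounded L B F ->
  `|ode_flow F t u - ode_flow F t w| <= expR (L * `|t|) * `|u - w|.
Proof.
move=> FLB; have [t0|/ltW t0] := leP 0 t.
  by rewrite !ode_flow_ge// (ger0_norm t0); exact: semiflow_lip FLB t0.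
rewrite !ode_flow_le// (ler0_norm t0).
by apply: (semiflow_lip _ _ (lipschitz_boundedN FLB)); rewrite oppr_ge0.
Qed.

Lemma ode_flow_lip_field L B F G e t u : lipschitz_bounded L B F ->
  lipschitz_bounded L B G -> (forall w, `|F w - G w| <= e) ->
  `|ode_flow F t u - ode_flow G t u| <= expR (L * `|t|) * (`|t| * e).
Proof.
move=> FLB GLB FGe; have [t0|/ltW t0] := leP 0 t.
  by rewrite !ode_flow_ge// (ger0_norm t0); exact: semiflow_lip_field FLB GLB t0 FGe.
rewrite !ode_flow_le// (ler0_norm t0).
apply: (semiflow_lip_field _ (lipschitz_boundedN FLB) (lipschitz_boundedN GLB)).
  by rewrite oppr_ge0.
by move=> w; rewrite -opprD normrN.
Qed.

Lemma ode_flow_time_lip L B F s t u : lipschitz_bounded L B F ->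
  `|ode_flow F t u - ode_flow F s u| <= B * `|t - s|.
Proof.
move=> FLB; rewrite -{1}(subrK s t) (ode_flowD _ _ _ FLB).
set w := ode_flow F s u; have [r0|/ltW r0] := leP 0 (t - s).
  by rewrite ode_flow_ge// (ger0_norm r0); exact: semiflow_bound FLB r0.
rewrite ode_flow_le// (ler0_norm r0).
by apply: (semiflow_bound _ (lipschitz_boundedN FLB)); rewrite oppr_ge0.
Qed.

Lemma lipschitz_continuous (f : R -> R) B :
  (forall x y, `|f x - f y| <= B * `|x - y|) -> continuous f.
Proof.
move=> fB x; apply/cvgrPdist_lt => e e0.
have B0 : 0 <= B.
  by have := fB 1 0; rewrite subr0 normr1 mulr1; apply: le_trans.
near=> y; apply: le_lt_trans (fB _ _) _.
have H : (B + 1) * `|x - y| < e.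
  rewrite mulrC -ltr_pdivlMr; last by lra.
  near: y; apply: (@cvgr_dist_lt _ _ _ _ _ id x); first exact: cvg_id.
  by rewrite divr_gt0//; lra.
apply: le_lt_trans H; rewrite ler_wpM2r//; lra.
Unshelve. all: by end_near.
Qed.

Lemma ode_flow_continuous L B F u :
  lipschitz_bounded L B F -> continuous (ode_flow F ^~ u).
Proof.
move=> FLB; apply: (@lipschitz_continuous _ B) => x y.
exact: ode_flow_time_lip FLB.
Qed.

Lemma ode_flow_zero F t u : F u = 0 -> ode_flow F t u = u.
Proof.
by move=> Fu; rewrite /ode_flow; case: ifP => _; rewrite semiflow_zero// Fu oppr0.
Qed.

Lemma ode_flow_shift L B F a t u : lipschitz_bounded L B F ->
  a + ode_flow (fun w => F (a + w)) t u = ode_flow F t (a + u).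
Proof.
move=> FLB; have [t0|/ltW t0] := leP 0 t.
  by rewrite !ode_flow_ge// (semiflow_shift _ _ FLB).
rewrite !ode_flow_le//.
by apply: (semiflow_shift _ _ (lipschitz_boundedN FLB)); rewrite oppr_ge0.
Qed.

(** * Orbits of a nonnegative field *)

Section NonnegativeField.
Context {F : R -> R} {L B : R}.
Hypothesis FLB : lipschitz_bounded L B F.
Hypothesis F0 : forall w, 0 <= F w.

Lemma ode_flow_homo u : {homo ode_flow F ^~ u : s t / s <= t}.
Proof.
move=> s t st; rewrite -(subrK s t) (ode_flowD _ _ _ FLB).
have ts : 0 <= t - s by rewrite subr_ge0.
by rewrite [leRHS]ode_flow_ge//; exact: semiflow_ge FLB _ _.
Qed.

(** By monotonicity an orbit that returns at time [t] has not moved before; the tangent estimate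
    then bounds [s * F u] by a multiple of [s ^+ 2] for small [s]. *)
Lemma ode_flow_fixed t u : 0 < t -> ode_flow F t u = u -> F u = 0.
Proof.
move=> t0 tu; have [L0 B0 _ _] := FLB.
have fix_s s : 0 <= s <= t -> ode_flow F s u = u.
  move=> /andP[s0 st]; apply/eqP; rewrite eq_le.
  rewrite -{2}tu ode_flow_homo//= -{1}(ode_flow0 F u); exact: ode_flow_homo.
apply/eqP; rewrite eq_le F0 andbT leNgt; apply/negP => Fu.
(* Small enough for [L * B * s < F u]; the added 1 keeps the denominator positive. *)
pose s := Num.min t (F u / (2 * (L * B + 1))).
have LB0 : 0 <= L * B by rewrite mulr_ge0.
have D0 : 0 < 2 * (L * B + 1) by lra.
have s0 : 0 < s by rewrite lt_min t0 divr_gt0.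
have st : s <= t by rewrite ge_min lexx.
have sF : s * (2 * (L * B + 1)) <= F u by rewrite -ler_pdivlMr// ge_min lexx orbT.
have := semiflow_tangent u FLB (ltW s0).
rewrite -ode_flow_ge ?(ltW s0)// fix_s ?(ltW s0)// subrr sub0r normrN.
rewrite ger0_norm ?mulr_ge0 ?(ltW s0)// expr2 mulrA [s * F u]mulrC ler_pM2r//.
nra.
Qed.

Lemma ode_flow_nz s u : F u != 0 -> F (ode_flow F s u) != 0.
Proof.
apply: contra => /eqP Fw; have := ode_flowK s u FLB.
by rewrite (ode_flow_zero _ Fw) => <-; rewrite Fw.
Qed.

Lemma ode_flow_strict u : F u != 0 -> {homo ode_flow F ^~ u : s t / s < t}.
Proof.
move=> Fu s t st; rewrite lt_neqAle ode_flow_homo ?(ltW st)// andbT.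
apply/eqP => E; have := ode_flow_nz s Fu; rewrite -subr_gt0 in st.
rewrite (ode_flow_fixed st) ?eqxx// -(ode_flowD _ _ _ FLB) subrK//.
Qed.

(** Such a point is fixed by the time-one map, by continuity of that map. *)
Lemma ode_flow_limit u l :
  (forall e, 0 < e -> exists t, `|ode_flow F t u - l| <= e /\
                               `|ode_flow F (1 + t) u - l| <= e) -> F l = 0.
Proof.
move=> H; apply: (@ode_flow_fixed 1) => //.
apply/eqP; rewrite -subr_eq0 -normr_le0; apply/ler_addgt0Pl => e e0.
rewrite addr0; set K := expR (L * `|1|).
have K0 : 0 <= K := expR_ge0 _.
have [|t [H1 H2]] := H (e / (K + 1)); first by rewrite divr_gt0//; lra.
have H3 := ode_flow_lip 1 l (ode_flow F t u) FLB.
rewrite -(ode_flowD _ _ _ FLB) -/K distrC in H3.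
rewrite distrC in H3; rewrite [X in _ <= _ * X]distrC in H3.
have H4 : K * `|ode_flow F t u - l| <= K * (e / (K + 1)) by rewrite ler_wpM2l.
have H5 : (K + 1) * (e / (K + 1)) = e by rewrite mulrC divfK//; lra.
have := ler_normD (ode_flow F 1 l - ode_flow F (1 + t) u) (ode_flow F (1 + t) u - l).
rewrite addrA subrK; rewrite mulrDl mul1r in H5; lra.
Qed.

(** Only a zero of the field can stop an orbit: if it never reaches [c] it is bounded above, and its
    supremum is a limit point of the kind in [ode_flow_limit]. *)
Lemma ode_flow_unbounded u c : F u != 0 -> u < c ->
  (forall t, ode_flow F t u != c) -> exists2 l, u < l <= c & F l = 0.
Proof.
move=> Fu uc nc; pose A := range (ode_flow F ^~ u).
have Ac t : ode_flow F t u <= c.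
  rewrite leNgt; apply/negP => ct.
  have [|r /eqP] := @continuous_IVT R (ode_flow F ^~ u) 0 t c
    (ode_flow_continuous FLB); last exact/negP.
  by rewrite ode_flow0 !ltW.
have supA : has_sup A.
  by split; [exists (ode_flow F 0 u), 0|exists c => _ [t _ <-]].
have Asup t : ode_flow F t u <= sup A by apply: (ub_le_sup (proj2 supA)); exists t.
exists (sup A).
  rewrite (lt_le_trans _ (Asup 1)) ?ge_sup//; last first.
  - by rewrite -{1}(ode_flow0 F u); exact: ode_flow_strict.
  - by move=> _ [t _ <-].
  - by case: supA.
apply: (@ode_flow_limit u) => e e0.
have [_ [t _ <-] H] := sup_adherent e0 supA.
exists t; have H1 := Asup t; have H2 := Asup (1 + t).
have H3 : ode_flow F t u <= ode_flow F (1 + t) u by apply: ode_flow_homo; lra.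
by split; rewrite ler_norml; apply/andP; split; lra.
Qed.

Lemma ode_flow_unboundedN u c : F u != 0 -> c < u ->
  (forall t, ode_flow F t u != c) -> exists2 l, c <= l < u & F l = 0.
Proof.
move=> Fu uc nc; pose A := range (ode_flow F ^~ u).
have Ac t : c <= ode_flow F t u.
  rewrite leNgt; apply/negP => ct.
  have [|r /eqP] := @continuous_IVT R (ode_flow F ^~ u) t 0 c
    (ode_flow_continuous FLB); last exact/negP.
  by rewrite ode_flow0 !ltW.
have infA : has_inf A.
  by split; [exists (ode_flow F 0 u), 0|exists c => _ [t _ <-]].
have Ainf t : inf A <= ode_flow F t u by apply: (ge_inf (proj2 infA)); exists t.
exists (inf A).
  rewrite (le_lt_trans (Ainf (-1))) ?lb_le_inf//.
  - by case: infA.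
  - by move=> _ [t _ <-].
  - by rewrite -{2}(ode_flow0 F u); apply: ode_flow_strict => //; lra.
apply: (@ode_flow_limit u) => e e0.
have [_ [t _ <-] H] := inf_adherent e0 infA.
exists (-1 + t); rewrite addrA subrr add0r; have H1 := Ainf t.
have H2 := Ainf (-1 + t).
have H3 : ode_flow F (-1 + t) u <= ode_flow F t u by apply: ode_flow_homo; lra.
by split; rewrite ler_norml; apply/andP; split; lra.
Qed.

End NonnegativeField.

End LipschitzFlow.

(** * Distance to the integers, and the multiples of the square root of two *)

Section DistanceToIntegers.
Context {R : realType}.
Implicit Types (a b e : R) (n m k : int).

(** The floor of [a + 2^-1] is an integer nearest to [a]. *)
Definition zdist a : R := `|a - (Num.floor (a + 2^-1))%:~R|.

Lemma zdist_ge0 a : 0 <= zdist a. Proof. exact: normr_ge0. Qed.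

Lemma zdist_half a : zdist a <= 2^-1.
Proof.
have := floor_itv (a + 2^-1); rewrite intrD => /andP[? ?].
by rewrite ler_norml; apply/andP; split; lra.
Qed.

Lemma zdist_le a n : zdist a <= `|a - n%:~R|.
Proof.
rewrite /zdist; set m := Num.floor _.
have := floor_itv (a + 2^-1); rewrite -/m intrD => /andP[m1 m2].
have [->//|nm] := eqVneq n m.
apply: (@le_trans _ _ 2^-1); first by rewrite ler_norml; apply/andP; split; lra.
case: (ltgtP n m) nm => // nm _.
  have : (n + 1)%:~R <= m%:~R :> R by rewrite ler_int lezD1.
  by rewrite intrD => H; rewrite ger0_norm; lra.
have : (m + 1)%:~R <= n%:~R :> R by rewrite ler_int lezD1.
by rewrite intrD => H; rewrite distrC ger0_norm; lra.
Qed.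

Lemma zdist_ex a : exists n, zdist a = `|a - n%:~R|.
Proof. by exists (Num.floor (a + 2^-1)). Qed.

Lemma zdist_norm a : zdist a <= `|a|.
Proof. by have := zdist_le a 0; rewrite subr0. Qed.

Lemma zdistN a : zdist (- a) = zdist a.
Proof.
suff H b : zdist (- b) <= zdist b.
  by apply/eqP; rewrite eq_le H -{1}[a]opprK H.
have [n ->] := zdist_ex b; apply: le_trans (zdist_le _ (- n)) _.
by rewrite intrN -opprD normrN.
Qed.

Lemma zdistD a b : zdist (a + b) <= zdist a + zdist b.
Proof.
have [n ->] := zdist_ex a; have [m ->] := zdist_ex b.
apply: le_trans (zdist_le _ (n + m)) _; rewrite intrD opprD addrACA.
exact: ler_normD.
Qed.

Lemma zdistDz a n : zdist (a + n%:~R) = zdist a.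
Proof.
suff H b m : zdist (b + m%:~R) <= zdist b.
  by apply/eqP; rewrite eq_le H -{1}(addrK n%:~R a) -intrN H.
have [k ->] := zdist_ex b; apply: le_trans (zdist_le _ (k + m)) _.
by rewrite intrD opprD addrACA subrr addr0.
Qed.

Lemma zdist_eq0 a : zdist a = 0 -> exists n, a = n%:~R.
Proof.
have [n ->] := zdist_ex a => /normr0_eq0/eqP; rewrite subr_eq0 => /eqP ->.
by exists n.
Qed.

Lemma zdistz n : zdist n%:~R = 0.
Proof.
by apply/eqP; rewrite eq_le zdist_ge0 (le_trans (zdist_le _ n))// subrr normr0.
Qed.

Lemma zdist_small a : `|a| <= 2^-1 -> zdist a = `|a|.
Proof.
move=> a2; apply/eqP; rewrite eq_le zdist_norm /=.
have [n ->] := zdist_ex a; have [->|n0] := eqVneq n 0; first by rewrite subr0.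
have : 1 <= `|n%:~R| :> R.
  by rewrite -intr_norm (ler_int R 1) -gtz0_ge1 normr_gt0.
have := lerB_dist n%:~R a; rewrite distrC; lra.
Qed.

End DistanceToIntegers.

Section SquareRootOfTwo.
Context {R : realType}.
Implicit Types (e y : R).

Definition slope : R := Num.sqrt 2.

Lemma slope_gt0 : 0 < slope. Proof. by rewrite sqrtr_gt0. Qed.

Lemma slope_sqr : slope * slope = 2.
Proof. by rewrite -expr2 sqr_sqrtr. Qed.

Lemma slope_bounds : 1 < slope < 3 / 2.
Proof.
by have := slope_gt0; have := slope_sqr => H1 H2; apply/andP; split; nra.
Qed.

(** The exponent of 2 is odd in [2 * k ^+ 2] and even in [m ^+ 2]. *)
Lemma slope_irrational (k m : int) : k%:~R * slope = m%:~R -> k = 0.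
Proof.
move=> H; apply/eqP; case: (eqVneq k 0) => // k0.
have : (2 * k ^+ 2)%:~R = (m ^+ 2)%:~R :> R.
  by rewrite intrM !rmorphXn /= -H exprMn [slope ^+ 2]expr2 slope_sqr mulrC.
move/eqP; rewrite eqr_int => /eqP/(congr1 absz).
rewrite abszM !abszX => E.
have k0' : (0 < `|k|)%N by rewrite absz_gt0.
have m0 : (0 < `|m|)%N.
  rewrite lt0n; apply/eqP => m0; move: E; rewrite m0 exp0n// => /eqP.
  by rewrite muln_eq0 expn_eq0 /= eqn0Ngt k0'.
have := congr1 (logn 2) E; rewrite lognM ?expn_gt0 ?k0'// !lognX.
by move/(congr1 odd); rewrite oddD !oddM.
Qed.

(** The witnesses are the odd powers of [slope - 1]: multiplying by its square [3 - 2 * slope]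
    shrinks the value while keeping it positive and of the form [b * slope - a] with natural [a] and
    [b]. *)
Lemma slope_small e : 0 < e ->
  exists (b : nat) (m : int), 0 < b%:R * slope + m%:~R < e.
Proof.
move=> e0; have /andP[s1 s2] := slope_bounds; have s3 := slope_sqr.
pose x := 3 - 2 * slope; have x0 : 0 < x by rewrite /x; nra.
have x1 : x < 1 by rewrite /x; lra.
have H k : exists (b a : nat), b%:R * slope - a%:R = x ^+ k * (slope - 1).
  elim: k => [|k [b [a IH]]].
    by exists 1%N, 1%N; rewrite expr0 mul1r mulr1n mul1r.
  exists (3 * b + 2 * a)%N, (4 * b + 3 * a)%N.
  rewrite exprS -mulrA -IH /x.
  have -> : (3 * b + 2 * a)%:R = 3 * b%:R + 2 * a%:R :> R by rewrite natrD !natrM.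
  have -> : (4 * b + 3 * a)%:R = 4 * b%:R + 3 * a%:R :> R by rewrite natrD !natrM.
  by move: s3 => /(congr1 ( *%R (2 * b%:R))) s3; lra.
have : (fun k => x ^+ k) @ \oo --> 0 by apply: cvg_expr; rewrite ger0_norm ?ltW.
move/cvgrPdist_lt => /(_ _ e0) [k _ /(_ k (leqnn k))] /=.
rewrite sub0r normrN ger0_norm ?exprn_ge0 ?(ltW x0)// => xe.
have [b [a Hk]] := H k; exists b, (- a%:Z); rewrite intrN Hk.
have xk : 0 < x ^+ k by rewrite exprn_gt0.
by apply/andP; split; nra.
Qed.

(** Steps of a small length [d], equal to [b * slope] modulo 1, carry [y] up to the next integer
    without jumping over its neighbourhood. Only nonnegative multiples occur, as is needed when one
    end of a leaf alone is available. *)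
Lemma slope_dense y e : 0 < e -> exists n : nat, zdist (y + n%:R * slope) < e.
Proof.
move=> e0; have [b [m /andP[d0 de]]] := slope_small e0.
set d := _ + _ in d0 de.
pose N := Num.floor y + 1; pose j := Num.truncn ((N%:~R - y) / d).
have yN : 0 <= N%:~R - y.
  by have /andP[_] := floor_itv y; rewrite -/N; lra.
have /andP[j1 j2] : j%:R <= (N%:~R - y) / d < j.+1%:R.
  by apply: truncn_itv; rewrite divr_ge0// ltW.
rewrite ler_pdivlMr// in j1; rewrite ltr_pdivrMr// -natr1 mulrDl mul1r in j2.
exists (j * b)%N.
have -> : y + (j * b)%:R * slope = (y + j%:R * d - N%:~R) + (N - j%:Z * m)%:~R.
  by rewrite /d intrB intrM natrM; ring.
rewrite zdistDz; apply: le_lt_trans (zdist_norm _) _.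
by rewrite ltr_norml; apply/andP; split; lra.
Qed.

End SquareRootOfTwo.

(** * The torus *)

Section TorusDistance.
Context {R : realType}.
Implicit Types X Y Z : R * R.

Definition tdist X Y : R := Num.max (zdist (X.1 - Y.1)) (zdist (X.2 - Y.2)).

Definition congruent X Y : Prop :=
  exists n m : int, X = (Y.1 + n%:~R, Y.2 + m%:~R).

Lemma tdist_sym X Y : tdist X Y = tdist Y X.
Proof. by rewrite /tdist -zdistN opprB -[zdist (X.2 - _)]zdistN opprB. Qed.

Lemma tdist_triangle Y X Z : tdist X Z <= tdist X Y + tdist Y Z.
Proof.
have T a b c : zdist (a - c) <= zdist (a - b) + zdist (b - c) :> R.
  by have := zdistD (a - b) (b - c); rewrite addrA subrK.
rewrite {1}/tdist ge_max; apply/andP; split.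
  by apply: le_trans (T _ Y.1 _) _; apply: lerD; rewrite le_max lexx.
by apply: le_trans (T _ Y.2 _) _; apply: lerD; rewrite le_max lexx orbT.
Qed.

Lemma tdist_eq0 X Y : tdist X Y = 0 <-> congruent X Y.
Proof.
split=> [XY|[n [m ->]]].
  have H1 : zdist (X.1 - Y.1) = 0.
    by apply/eqP; rewrite eq_le zdist_ge0 -XY le_max lexx.
  have H2 : zdist (X.2 - Y.2) = 0.
    by apply/eqP; rewrite eq_le zdist_ge0 -XY le_max lexx orbT.
  have [n En] := zdist_eq0 H1; have [m Em] := zdist_eq0 H2.
  by exists n, m; rewrite -En -Em [LHS]surjective_pairing; congr pair; ring.
by rewrite /tdist /= ![_ + _ - _]addrAC !subrr !add0r !zdistz maxxx.
Qed.

Lemma tdist_congruent X Y Z : congruent X Y -> tdist X Z = tdist Y Z.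
Proof.
move=> /tdist_eq0 XY; apply/eqP; rewrite eq_le; apply/andP; split.
  by apply: le_trans (tdist_triangle Y X Z) _; rewrite XY add0r.
by apply: le_trans (tdist_triangle X Y Z) _; rewrite tdist_sym XY add0r.
Qed.

Lemma tdist_half X Y : tdist X Y <= 2^-1.
Proof. by rewrite ge_max !zdist_half. Qed.

Lemma tdist_norm X Y : tdist X Y <= Num.max `|X.1 - Y.1| `|X.2 - Y.2|.
Proof. by rewrite ge_max !le_max !zdist_norm ?orbT. Qed.

End TorusDistance.

(** The half-open unit square picks one representative per class, so equality of points is plain
    equality; the topology is the one of the quotient metric [tdist]. *)
Record torus (R : realType) := Torus {
  trep : R * R;
  trep_in : (0 <= trep.1 < 1) && (0 <= trep.2 < 1)
}.

HB.instance Definition _ (R : realType) := [isSub for @trep R].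
HB.instance Definition _ (R : realType) := [Choice of torus R by <:].

Section TorusMetric.
Context {R : realType}.
Implicit Types (x y : torus R) (X Y : R * R).

Definition torus_dist x y : R := tdist (trep x) (trep y).

Lemma torus_distxx x : torus_dist x x = 0.
Proof.
apply/tdist_eq0; exists 0, 0; rewrite !addr0; exact: surjective_pairing.
Qed.

Lemma unit_interval_int (a b : R) (n : int) :
  0 <= a < 1 -> 0 <= b < 1 -> a = b + n%:~R -> a = b.
Proof.
move=> /andP[a0 a1] /andP[b0 b1] E.
suff n0 : n = 0 by rewrite E n0 addr0.
have n1 : n < 1 by rewrite -(ltr_int R) mulr1z; lra.
have n2 : -1 < n by rewrite -(ltr_int R) mulrN1z; lra.
lia.
Qed.

Lemma torus_dist_eq0 x y : torus_dist x y = 0 -> x = y.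
Proof.
move=> /tdist_eq0[n [m E]]; apply: val_inj => /=.
have /andP[x1 x2] := trep_in x; have /andP[y1 y2] := trep_in y.
rewrite [LHS]surjective_pairing [RHS]surjective_pairing; congr pair.
  by apply: unit_interval_int x1 y1 _; rewrite E.
by apply: unit_interval_int x2 y2 _; rewrite E.
Qed.

Lemma torus_dist_sym x y : torus_dist x y = torus_dist y x.
Proof. exact: tdist_sym. Qed.

Lemma torus_dist_triangle y x z :
  torus_dist x z <= torus_dist x y + torus_dist y z.
Proof. exact: tdist_triangle. Qed.

HB.instance Definition _ := isMetric.Build R (torus R)
  torus_distxx torus_dist_eq0 torus_dist_sym torus_dist_triangle.

Definition frac_part (a : R) : R := a - (Num.floor a)%:~R.

Lemma frac_part_itv a : 0 <= frac_part a < 1.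
Proof.
rewrite /frac_part; have := floor_itv a; rewrite intrD => /andP[? ?].
by apply/andP; split; lra.
Qed.

Lemma tproj_subproof X :
  (0 <= (frac_part X.1, frac_part X.2).1 < 1) &&
  (0 <= (frac_part X.1, frac_part X.2).2 < 1).
Proof. by rewrite !frac_part_itv. Qed.

Definition tproj X : torus R := Torus (tproj_subproof X).

Lemma congruent_trep X : congruent (trep (tproj X)) X.
Proof. by exists (- Num.floor X.1), (- Num.floor X.2); rewrite !intrN. Qed.

Lemma mdist_tproj X Y : mdist (tproj X) (tproj Y) = tdist X Y.
Proof.
rewrite [LHS](tdist_congruent _ (congruent_trep X)) tdist_sym.
by rewrite (tdist_congruent _ (congruent_trep Y)) tdist_sym.
Qed.

Lemma tproj_congruent X Y : congruent X Y -> tproj X = tproj Y.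
Proof. by move=> /tdist_eq0 E; apply: mdist_positivity; rewrite mdist_tproj. Qed.

Lemma congruent_tproj X Y : tproj X = tproj Y -> congruent X Y.
Proof. by move=> E; apply/tdist_eq0; rewrite -mdist_tproj E mdistxx. Qed.

Lemma trepK x : tproj (trep x) = x.
Proof.
apply: mdist_positivity.
by rewrite [LHS](tdist_congruent _ (congruent_trep _)); exact: torus_distxx.
Qed.

(** The lift is shifted in each coordinate by the integer that brings it nearest to [X]. *)
Lemma lift_near X y : exists Y, [/\ tproj Y = y,
  `|Y.1 - X.1| <= mdist (tproj X) y & `|Y.2 - X.2| <= mdist (tproj X) y].
Proof.
set Z := trep y.
have [n En] := zdist_ex (X.1 - Z.1); have [m Em] := zdist_ex (X.2 - Z.2).
have -> : mdist (tproj X) y = tdist X Z by rewrite -{1}(trepK y) mdist_tproj.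
exists (Z.1 + n%:~R, Z.2 + m%:~R); rewrite /tdist En Em.
split=> /=.
- by rewrite -[RHS]trepK; apply: tproj_congruent; exists n, m.
- by rewrite le_max distrC opprD addrA lexx.
- by rewrite le_max orbC distrC opprD addrA lexx.
Qed.

Lemma tproj_continuous : continuous tproj.
Proof.
move=> X; apply/cvg_ballP => e e0; near=> Y.
rewrite ballEmdist /= mdist_tproj; apply: le_lt_trans (tdist_norm _ _) _.
have : ball X e Y by near: Y; exact: (nbhsx_ballx X e e0).
by move=> [H1 H2]; rewrite gt_max; apply/andP; split; [exact: H1|exact: H2].
Unshelve. all: by end_near.
Qed.

Lemma torus_compact : compact [set: torus R].
Proof.
have -> : [set: torus R] = tproj @` (`[0, 1]%classic `*` `[0, 1]%classic).
  apply/seteqP; split=> // x _; exists (trep x); last exact: trepK.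
  have /andP[/andP[a b] /andP[c d]] := trep_in x.
  by split; rewrite /= in_itv/= ?a ?c /= ltW.
apply: continuous_compact.
  by apply: continuous_subspaceT; exact: tproj_continuous.
by apply: compact_setX; exact: segment_compact.
Qed.

End TorusMetric.

(** * The slowed linear flow *)

Section SlowedFlow.
Context {R : realType}.
Implicit Types (X Y : R * R) (x y : torus R) (s t u w e : R).

Definition leaf X u : R * R := (X.1 + u, X.2 + slope * u).

(** A field that vanishes exactly over [rest] and is Lipschitz, so that [rest] is never reached in
    finite time from elsewhere. *)
Definition speed X u : R := tdist (leaf X u) (0, 0).

Definition drift X t : R := ode_flow (speed X) t 0.

Definition rest : torus R := tproj (0, 0).

Definition torus_flow t x : torus R := tproj (leaf (trep x) (drift (trep x) t)).

Lemma leaf0 X : leaf X 0 = X.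
Proof. by rewrite /leaf mulr0 !addr0 -surjective_pairing. Qed.

Lemma leafD X u w : leaf (leaf X u) w = leaf X (u + w).
Proof. by rewrite /leaf /= mulrDr !addrA. Qed.

Lemma tdist_leaf X Y u w e : `|X.1 - Y.1| <= e -> `|X.2 - Y.2| <= e ->
  tdist (leaf X u) (leaf Y w) <= e + 2 * `|u - w|.
Proof.
move=> H1 H2; apply: le_trans (tdist_norm _ _) _; rewrite /leaf /=.
have /andP[s1 s2] := @slope_bounds R.
have n0 := normr_ge0 (u - w).
rewrite ge_max; apply/andP; split.
  by rewrite opprD addrACA (le_trans (ler_normD _ _))//; lra.
rewrite opprD addrACA -mulrBr (le_trans (ler_normD _ _))// normrM.
by rewrite (ger0_norm (ltW slope_gt0)) lerD// ler_wpM2r//; lra.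
Qed.

Lemma tdist_lip X Y Z : `|tdist X Z - tdist Y Z| <= tdist X Y.
Proof.
have := tdist_triangle Y X Z; have := tdist_triangle X Y Z.
by rewrite (tdist_sym Y X) => ? ?; rewrite ler_norml; apply/andP; split; lra.
Qed.

Lemma speed_ge0 X u : 0 <= speed X u.
Proof. by rewrite /speed /tdist le_max zdist_ge0. Qed.

Lemma speed_lipschitz X : lipschitz_bounded 2 1 (speed X).
Proof.
split=> // [u w|u]; last first.
  by rewrite ger0_norm ?speed_ge0// (le_trans (tdist_half _ _))//; lra.
apply: le_trans (tdist_lip _ _ _) _.
have := @tdist_leaf X X u w 0; rewrite !subrr normr0 add0r; exact.
Qed.

Lemma speed_near X Y e u : `|X.1 - Y.1| <= e -> `|X.2 - Y.2| <= e ->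
  `|speed X u - speed Y u| <= e.
Proof.
move=> H1 H2; apply: le_trans (tdist_lip _ _ _) _.
by have := tdist_leaf u u H1 H2; rewrite subrr normr0 mulr0 addr0.
Qed.

Lemma congruent_leaf X Y u : congruent X Y -> congruent (leaf X u) (leaf Y u).
Proof.
by move=> [n [m ->]]; exists n, m; rewrite /leaf /= ![_ + _%:~R + _]addrAC.
Qed.

Lemma congruent_speed X Y : congruent X Y -> speed X = speed Y.
Proof.
move=> XY; apply/funext => u; exact/tdist_congruent/congruent_leaf.
Qed.

Lemma torus_flow_tproj t X : torus_flow t (tproj X) = tproj (leaf X (drift X t)).
Proof.
rewrite /torus_flow /drift (congruent_speed (congruent_trep X)).
exact/tproj_congruent/congruent_leaf/congruent_trep.
Qed.

Lemma speed_leaf X a : speed (leaf X a) = (fun w => speed X (a + w)).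
Proof. by apply/funext => w; rewrite /speed leafD. Qed.

Lemma drift0 X : drift X 0 = 0. Proof. exact: ode_flow0. Qed.

(** The cocycle relation behind the group law: moving the base point along the leaf translates the
    field. *)
Lemma driftD X s t : drift X (s + t) = drift X t + drift (leaf X (drift X t)) s.
Proof.
set a := drift X t; rewrite {2}/drift speed_leaf.
rewrite (ode_flow_shift _ _ _ (speed_lipschitz X)) addr0.
by rewrite /a /drift (ode_flowD _ _ _ (speed_lipschitz X)).
Qed.

Lemma torus_flow_continuous :
  continuous (fun p : R * torus R => torus_flow p.1 p.2).
Proof.
move=> [t0 x0]; apply/cvg_ballP => e e0.
set X := trep x0; set K := expR (2 * `|t0|).
have K0 : 0 <= K := expR_ge0 _.
have D0 : 0 < 4 + 2 * (K * `|t0|).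
  by have : 0 <= K * `|t0| by [rewrite mulr_ge0]; lra.
(* The total error is at most [d] for the base point plus [2 * (K * |t0| * d + d)] for the leaf
   parameter, and 4 instead of 3 leaves room. *)
pose d := e / (4 + 2 * (K * `|t0|)).
have d0 : 0 < d by rewrite divr_gt0.
near=> p; have : ball (t0, x0) d p by near: p; exact: (nbhsx_ballx (t0, x0) d d0).
set t := p.1; set x := p.2 => -[/= Ht Hx].
have {}Ht : `|t0 - t| < d by exact: Ht.
have {}Hx : mdist x0 x < d by move: Hx; rewrite ballEmdist.
rewrite ballEmdist /=.
have [Y [Yx Y1 Y2]] := lift_near X x; rewrite trepK in Y1 Y2.
rewrite -{1}(trepK x0) -Yx !torus_flow_tproj mdist_tproj.
have H1 : `|X.1 - Y.1| <= d by rewrite distrC (le_trans Y1)// ltW.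
have H2 : `|X.2 - Y.2| <= d by rewrite distrC (le_trans Y2)// ltW.
apply: le_lt_trans (tdist_leaf _ _ H1 H2) _.
have H3 : `|drift X t0 - drift Y t0| <= K * (`|t0| * d).
  apply: (ode_flow_lip_field _ _ (speed_lipschitz X) (speed_lipschitz Y)).
  by move=> w; exact: speed_near.
have H4 : `|drift Y t0 - drift Y t| <= 1 * `|t0 - t|.
  exact: ode_flow_time_lip (speed_lipschitz Y).
have := ler_normD (drift X t0 - drift Y t0) (drift Y t0 - drift Y t).
rewrite addrA subrK.
have : d * (4 + 2 * (K * `|t0|)) = e by rewrite divfK//; lra.
rewrite -/X; set z := `|drift X t0 - drift Y t|; nra.
Unshelve. all: by end_near.
Qed.

Lemma torus_flow_flow : continuous_flow torus_flow.
Proof.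
split=> [|x|s t x]; first exact: torus_flow_continuous.
  by rewrite /torus_flow drift0 leaf0 trepK.
rewrite [torus_flow t x]/torus_flow torus_flow_tproj leafD -driftD.
by rewrite /torus_flow.
Qed.

(** Leaves are injectively immersed because the slope is irrational; in particular a leaf passes
    through [rest] at most once. *)
Lemma congruent_leaf_inj X u w : congruent (leaf X u) (leaf X w) -> u = w.
Proof.
move=> [n [m []]] /= H1 H2.
have En : n%:~R = u - w :> R by lra.
have E : n%:~R * slope = m%:~R :> R by rewrite En mulrC mulrBr; lra.
move: H1; rewrite (slope_irrational E); lra.
Qed.

Lemma speed_eq0 X u : speed X u = 0 <-> tproj (leaf X u) = rest.
Proof.
split=> [/tdist_eq0|/congruent_tproj] H; first exact: tproj_congruent.
exact/tdist_eq0.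
Qed.

Lemma speed_eq0_inj X u w : speed X u = 0 -> speed X w = 0 -> u = w.
Proof.
move=> /speed_eq0 Hu /speed_eq0 Hw; apply: (@congruent_leaf_inj X).
by apply: congruent_tproj; rewrite Hu Hw.
Qed.

Lemma speed0_neq0 X : tproj X != rest -> speed X 0 != 0.
Proof. by apply: contra => /eqP/speed_eq0; rewrite leaf0 => ->. Qed.

Lemma drift_rest X t : tproj X = rest -> drift X t = 0.
Proof. by rewrite -{1}(leaf0 X) => /speed_eq0; exact: ode_flow_zero. Qed.

Lemma drift_strict X : tproj X != rest -> {homo drift X : s t / s < t}.
Proof.
move=> /speed0_neq0 X0; exact: (ode_flow_strict (speed_lipschitz X) (speed_ge0 X) X0).
Qed.

Lemma drift_continuous X : continuous (drift X).
Proof. exact: ode_flow_continuous (speed_lipschitz X). Qed.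

Lemma drift_reachP X c : tproj X != rest -> (forall t, drift X t != c) ->
  (exists2 l, 0 < l <= c & speed X l = 0) \/
  (exists2 l, c <= l < 0 & speed X l = 0).
Proof.
move=> /speed0_neq0 X0 nc; case: (ltgtP c 0) => c0.
- by right; apply: (ode_flow_unboundedN (speed_lipschitz X) (speed_ge0 X) X0 c0).
- by left; apply: (ode_flow_unbounded (speed_lipschitz X) (speed_ge0 X) X0 c0).
- by have := nc 0; rewrite drift0 c0 eqxx.
Qed.

End SlowedFlow.

Section Reparametrization.
Context {R : realType}.
Implicit Types f g h : R -> R.

(** The inverse is continuous for order reasons: [k d] is within [e] of [k c] as soon as [d] lies
    between the values of [f] at [k c - e] and [k c + e]. *)
Lemma increasing_surjective_inverse f :
  {homo f : s t / s < t} -> (forall c, exists t, f t = c) ->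
  exists k, [/\ cancel f k, cancel k f, {homo k : s t / s < t} & continuous k].
Proof.
move=> flt fsurj; have [k fk] := choice fsurj.
have flW := leW_mono (le_mono flt).
have kf : cancel f k by move=> t; apply: (inc_inj (le_mono flt)); exact: fk.
exists k; split=> // [s t st|c]; first by rewrite -flW !fk.
apply/cvgrPdist_lt => e e0; near=> d.
rewrite distrC ltr_distl -(flW (k c - e)) -(flW (k d)) !fk; apply/andP; split; near: d.
  by apply: lt_nbhsr; rewrite -[ltRHS]fk flW ltrBlDr ltrDl.
by apply: lt_nbhsl; rewrite -[ltLHS]fk flW ltrDl.
Unshelve. all: by end_near.
Qed.

Lemma increasing_reparametrization f g :
  {homo f : s t / s < t} -> continuous f -> (forall c, exists t, f t = c) ->
  {homo g : s t / s < t} -> continuous g -> (forall c, exists t, g t = c) ->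
  exists s : R -> R,
    [/\ homeomorphism s, {homo s : x y / x < y} & forall t, g (s t) = f t].
Proof.
move=> flt fc fs glt gc gs.
have [f' [ff' f'f _ f'c]] := increasing_surjective_inverse flt fs.
have [g' [gg' g'g g'lt g'c]] := increasing_surjective_inverse glt gs.
exists (g' \o f); split=> [|x y xy|t] /=; last 2 first.
- by apply: g'lt; exact: flt.
- exact: g'g.
split; first by move=> t; apply: continuous_comp; [exact: fc|exact: g'c].
exists (f' \o g); split=> [t|t|t] /=.
- by rewrite g'g ff'.
- by rewrite f'f gg'.
- by apply: continuous_comp; [exact: gc|exact: f'c].
Qed.

End Reparametrization.

(** * Failure of expansiveness *)

Section NotExpansive.
Context {R : realType}.

(** A leaf through a rational, non-integral height on the vertical axis misses the lattice: hitting
    it would give a rational relation for the slope. Hence nothing stops the drift. *)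
Lemma vertical_drift_surj (q : R) (k j : int) :
  k != 0 -> k%:~R * q = j%:~R -> 0 < q < 1 ->
  tproj (0, q) != rest /\ forall c, exists t, drift (0, q) t = c.
Proof.
move=> k0 kq /andP[q0 q1].
have nz u : speed (0, q) u <> 0.
  move=> /tdist_eq0[n [m]]; rewrite /leaf /= !add0r => -[un qm].
  have kn : (k * n)%:~R * slope = (k * m - j)%:~R :> R.
    by rewrite intrB !intrM -kq -un -qm; ring.
  have /eqP := slope_irrational kn.
  rewrite mulf_eq0 (negbTE k0) /= => /eqP n0.
  move: qm; rewrite un n0 mulr0 addr0 => qm.
  have m0 : 0 < m by rewrite -(ltr_int R); lra.
  have m1 : m < 1 by rewrite -(ltr_int R) mulr1z; lra.
  lia.
have X0 : tproj (0, q) != rest.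
  by apply/eqP => /= E; apply: (nz 0); apply/speed_eq0; rewrite leaf0.
split=> // c; apply: contrapT => nc.
have [t|[l _ /nz]|[l _ /nz]]// := @drift_reachP R (0, q) c X0.
by apply/eqP => tc; apply: nc; exists t.
Qed.

Lemma torus_flow_not_expansive : ~ expansive (@torus_flow R).
Proof.
move=> /(_ 1 ltr01)[d d0 H].
(* The offset [c] is rational, smaller than [d], and at most a third so that [2^-1 + c] stays below
   1. *)
pose N := (Num.truncn d^-1).+3; pose c : R := N%:R^-1.
have N3 : 3 <= N%:R :> R by rewrite (ler_nat R 3).
have N0 : 0 < N%:R :> R by lra.
have Nc : N%:R * c = 1 by rewrite mulfV//; lra.
have c0 : 0 < c by rewrite invr_gt0.
have c3 : c <= 3^-1 by nra.
have cd : c < d.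
  rewrite -[d]invrK ltf_pV2 ?posrE ?invr_gt0//.
  have : 0 <= d^-1 by rewrite invr_ge0 ltW.
  move=> /truncn_itv/andP[_]/lt_le_trans; apply.
  by rewrite ler_nat /N -addn3 -addn1 leq_add2l.
have [X0 Xs] : tproj (0, 2^-1 : R) != rest /\
    forall u, exists t, drift (0, 2^-1 : R) t = u.
  by apply: (@vertical_drift_surj _ 2 1) => //; [rewrite mulfV|lra].
have [Y0 Ys] : tproj (0, 2^-1 + c) != rest /\
    forall u, exists t, drift (0, 2^-1 + c) t = u.
  apply: (@vertical_drift_surj _ (2 * N%:Z) (N%:Z + 2)) => //.
  - by rewrite intrM intrD -!pmulrn; lra.
  - lra.
set X := (0, 2^-1) in X0 Xs *; set Y := (0, 2^-1 + c) in Y0 Ys *.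
have [s [sh sm sE]] := increasing_reparametrization (drift_strict X0)
  (@drift_continuous _ X) Xs (drift_strict Y0) (@drift_continuous _ Y) Ys.
have s0 : s 0 = 0.
  by apply: (inc_inj (le_mono (drift_strict Y0))); rewrite sE !drift0.
have spos t : 0 < t -> 0 < s t by rewrite -{2}s0; exact: sm.
have [|tau _] := H (tproj X) (tproj Y) s sh s0 spos.
  move=> t; rewrite !torus_flow_tproj mdist_tproj sE.
  apply: le_lt_trans (tdist_norm _ _) _; rewrite /leaf /= subrr normr0.
  rewrite gt_max d0 /=; set z := slope * _.
  have -> : 2^-1 + z - (2^-1 + c + z) = - c by ring.
  by rewrite normrN ger0_norm ?(ltW c0).
rewrite torus_flow_tproj => /congruent_tproj[n [m]].
set a := drift X tau; rewrite /leaf /= !add0r => -[an cm].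
(* Clearing the denominator of [c] turns membership in the same orbit into a rational relation for
   the slope; so the points share no orbit, whatever the allowed time shift. *)
have E : (N%:Z * n)%:~R * slope = (N%:Z * m - 1)%:~R :> R.
  have Em : m%:~R = c - slope * a :> R by lra.
  have En : n%:~R = - a :> R by lra.
  rewrite intrB !intrM -!pmulrn Em En mulr1n mulrBr Nc; ring.
have /eqP := slope_irrational E; rewrite mulf_eq0 /= => /eqP n0.
rewrite n0 in an; have m0 : m%:~R = c :> R.
  have a0 : a = 0 by lra.
  by rewrite a0 mulr0 addr0 in cm; lra.
have m1 : 0 < m by rewrite -(ltr_int R) m0.
have m2 : m < 1 by rewrite -(ltr_int R) mulr1z m0; lra.
lia.
Qed.

End NotExpansive.

(** * Time changes of the slowed flow *)

Section CompactMetric.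
Context {R : realType} {M : metricType R}.

Lemma mdist_lip (x y x' y' : M) :
  `|mdist x y - mdist x' y'| <= mdist x x' + mdist y y'.
Proof.
have := metric_triangle x x' y; have := metric_triangle x' y' y.
have := metric_triangle x' x y'; have := metric_triangle x y y'.
rewrite (metric_sym x' x) (metric_sym y' y) => ? ? ? ?.
by rewrite ler_norml; apply/andP; split; lra.
Qed.

Lemma mdist_continuous (T : topologicalType) (f g : T -> M) :
  continuous f -> continuous g -> continuous (fun t => mdist (f t) (g t)).
Proof.
move=> fc gc t; apply/cvgrPdist_lt => e e0.
have e2 : 0 < e / 2 by rewrite divr_gt0.
near=> u; apply: le_lt_trans (mdist_lip _ _ _ _) _.
have : ball (f t) (e / 2) (f u) by near: u; move/cvg_ballP: (fc t); apply.
have : ball (g t) (e / 2) (g u) by near: u; move/cvg_ballP: (gc t); apply.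
by rewrite !ballEmdist /=; lra.
Unshelve. all: by end_near.
Qed.

(** The displacements form a compact, hence closed, set of reals that misses 0. *)
Lemma compact_displacement (C : set M) (f : M -> M) :
  compact C -> continuous f -> (forall z, C z -> f z <> z) ->
  exists2 m : R, 0 < m & forall z, C z -> m <= mdist z (f z).
Proof.
move=> Ccpt fc fC; pose g z := mdist z (f z).
have gcpt : compact (g @` C).
  apply: continuous_compact Ccpt; apply: continuous_subspaceT.
  by apply: mdist_continuous => // z; exact: cvg_id.
have gcl : closed (g @` C) by apply: compact_closed gcpt; exact: Rhausdorff.
have : nbhs (0 : R) (~` (g @` C)).
  apply: open_nbhs_nbhs; split; first exact: closed_openC.
  by move=> [z Cz gz]; apply: (fC z Cz); apply/esym/mdist_positivity.
move=> /nbhs_ballP[m /= m0 mC]; exists m => // z Cz.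
rewrite leNgt; apply/negP => gm; apply: (mC (g z)); last by exists z.
by rewrite /ball /= sub0r normrN ger0_norm// mdist_ge0.
Qed.

End CompactMetric.

Section TimeChange.
Context {R : realType} (psi : R -> torus R -> torus R).
Hypothesis psi_flow : continuous_flow psi.
Hypothesis psi_change : time_change psi (@torus_flow R).
Implicit Types (X Y : R * R) (x y z : torus R) (s t u e d : R).

(** Here [a] is the leaf parameter reached at each time of [psi]. The last clause says that [psi]
    sweeps all that the slowed flow sweeps; monotonicity fails at [rest], where [a] may be
    constant. *)
Definition is_progress X (a : R -> R) : Prop :=
  [/\ continuous a, a 0 = 0, forall t, psi t (tproj X) = tproj (leaf X (a t)),
      tproj X != rest -> {homo a : s t / s < t} &
      forall r, exists t, a t = drift X r].

Lemma progress_ex X : exists a, is_progress X a.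
Proof.
have [s [[sc [g [sg gs gc]]] sm s0 sE]] := psi_change (tproj X).
exists (drift X \o s); split=> [t||t|X0 t u tu|r] /=.
- by apply: continuous_comp; [exact: sc|exact: drift_continuous].
- by rewrite s0 drift0.
- by rewrite sE torus_flow_tproj.
- by apply: drift_strict => //; exact: sm.
- by exists (g r); rewrite gs.
Qed.

Lemma psi_continuous t : continuous (psi t).
Proof.
move=> x; apply: (@continuous_comp _ _ _ (fun x => (t, x)) (fun p => psi p.1 p.2)).
  apply: (@cvg_pair _ _ _ (nbhs x) (nbhs t) (nbhs x)); last exact: cvg_id.
  exact: cvg_cst.
exact: (flow_continuous psi_flow).
Qed.

Lemma psiK t x : psi (- t) (psi t x) = x.
Proof. by rewrite -(flowD psi_flow) addNr (flow0 psi_flow). Qed.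

Lemma psi_rest t : psi t rest = rest.
Proof.
have [s [_ _ _ ->]] := psi_change rest.
by rewrite /rest torus_flow_tproj (@drift_rest _ (0, 0))// leaf0.
Qed.

Lemma psi_eq_rest t x : psi t x = rest -> x = rest.
Proof. by move=> E; rewrite -(psiK t x) E psi_rest. Qed.

Lemma progress_reach X a c : is_progress X a -> tproj X != rest ->
  ~ (exists t, a t = c) ->
  (exists2 l, 0 < l <= c & speed X l = 0) \/
  (exists2 l, c <= l < 0 & speed X l = 0).
Proof.
move=> [_ _ _ _ adrift] X0 nc; apply: drift_reachP => // r.
by apply/eqP => rc; apply: nc; have [t atr] := adrift r; exists t; rewrite atr.
Qed.

(* A leaf meets the lattice at most once, so at least one of its two ends is
   swept out entirely. *)
Lemma progress_one_sided X a : is_progress X a -> tproj X != rest ->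
  (forall c, 0 <= c -> exists t, a t = c) \/
  (forall c, c <= 0 -> exists t, a t = c).
Proof.
move=> Xa X0; have reach c := @progress_reach X a c Xa X0.
have [[l [l0 Xl]]|nl] := pselect (exists l, 0 < l /\ speed X l = 0).
  right=> c c0; apply: contrapT.
  move=> /reach[[l' /andP[l'0 l'c] Xl']|[l' /andP[_ l'0] Xl']].
    by move: (lt_le_trans l'0 l'c); rewrite ltNge c0.
  by move: l'0; rewrite -(speed_eq0_inj Xl Xl') ltNge ltW.
left=> c c0; apply: contrapT => /reach[[l' /andP[l'0 _] Xl']|[l' /andP[cl l'0] _]].
  by apply: nl; exists l'.
by move: (le_lt_trans cl l'0); rewrite ltNge c0.
Qed.

Lemma progress_avoids X a l t : is_progress X a -> tproj X != rest ->
  speed X l = 0 -> a t <> l.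
Proof.
move=> [_ _ aE _ _] X0 /speed_eq0 Xl atl; move/eqP: X0; apply.
by apply: (@psi_eq_rest t); rewrite aE atl.
Qed.

Lemma zdist_half_int (n : int) : zdist (n%:~R + 2^-1 : R) = 2^-1.
Proof. by rewrite addrC zdistDz zdist_small ?ger0_norm. Qed.

(** The value [2^-1] is the largest possible distance. It is attained where the first coordinate is
    a half-integer, and such points lie on both ends of the leaf. *)
Lemma psi_leaves x : x <> rest -> exists t, 2^-1 <= mdist (psi t x) rest.
Proof.
move=> /eqP; rewrite -{1}(trepK x); set X := trep x => X0.
have [a Xa] := progress_ex X; have [_ _ aE _ _] := Xa.
have far (n : int) : (exists t, a t = n%:~R + 2^-1 - X.1) ->
    exists t, 2^-1 <= mdist (psi t x) rest.
  move=> [t at_]; exists t; rewrite -(trepK x) -/X aE mdist_tproj /tdist le_max.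
  by rewrite at_ /leaf /= subr0 [X.1 + _]addrC subrK zdist_half_int lexx.
have := floor_itv X.1; rewrite intrD => /andP[f1 f2].
have [H|H] := progress_one_sided Xa X0.
  by apply: (far (Num.floor X.1 + 1)); apply: H; rewrite intrD; lra.
by apply: (far (Num.floor X.1 - 1)); apply: H; rewrite intrB; lra.
Qed.

(** Successive crossings of the vertical circle through [rest] have heights differing by [slope], so
    they come arbitrarily close to [rest] along either end of the leaf. *)
Lemma psi_approaches_rest x e : 0 < e -> exists t, mdist (psi t x) rest < e.
Proof.
move=> e0; have [->|/eqP] := pselect (x = rest).
  by exists 0; rewrite psi_rest mdistxx.
rewrite -{1}(trepK x); set X := trep x => X0.
have [a Xa] := progress_ex X; have [_ _ aE _ _] := Xa.
have near (k : int) (u : R) : X.1 + u = k%:~R -> zdist (X.2 + slope * u) < e ->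
    (exists t, a t = u) -> exists t, mdist (psi t x) rest < e.
  move=> Xu ue [t atu]; exists t; rewrite -(trepK x) -/X aE mdist_tproj /tdist.
  by rewrite gt_max atu /leaf /= !subr0 Xu zdistz e0.
have := floor_itv X.1; rewrite intrD => /andP[f1 f2].
have [H|H] := progress_one_sided Xa X0.
  pose v := (Num.floor X.1)%:~R + 1 - X.1.
  have [n ne] := slope_dense (X.2 + slope * v) e0.
  apply: (near (Num.floor X.1 + 1 + n%:Z) (v + n%:R)).
  - by rewrite !intrD -pmulrn /v; ring.
  - by rewrite mulrDr addrA [slope * n%:R]mulrC.
  - by apply: H; have : 0 <= n%:R :> R by []; rewrite /v; lra.
pose v := (Num.floor X.1)%:~R - X.1.
have [n ne] := slope_dense (- (X.2 + slope * v)) e0.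
apply: (near (Num.floor X.1 - n%:Z) (v - n%:R)).
- by rewrite intrB -pmulrn /v; ring.
- have -> : X.2 + slope * (v - n%:R) = - (- (X.2 + slope * v) + n%:R * slope) by ring.
  by rewrite zdistN.
- by apply: H; have : 0 <= n%:R :> R by []; rewrite /v; lra.
Qed.

(* Along times at which [x] comes ever closer to the fixed point, a cluster
   value of the orbit of [y] must stay close to the fixed point forever. *)
Lemma psi_simultaneous x y d : d < 2^-1 ->
  (forall t, mdist (psi t x) (psi t y) < d) ->
  forall e, 0 < e -> exists t, mdist (psi t x) rest < e /\ mdist (psi t y) rest < e.
Proof.
move=> d2 xyd e e0.
have /choice[tt ttn] : forall n : nat, exists t, mdist (psi t x) rest < n.+1%:R^-1.
  by move=> n; apply: psi_approaches_rest; rewrite invr_gt0.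
have [z [_ zcl]] : [set: torus R] `&` cluster ((fun n => psi (tt n) y) @ \oo) !=set0.
  by apply: torus_compact; exact: filterT.
have pick (P : set (torus R)) (eta : R) : 0 < eta -> nbhs z P ->
    exists t, mdist (psi t x) rest < eta /\ P (psi t y).
  move=> eta0 zP.
  have /zcl/(_ zP)[_ [[n nN <-] Pn]] :
      ((fun n => psi (tt n) y) @ \oo)
        [set psi (tt n) y | n in [set n | n.+1%:R^-1 < eta]].
    by apply: (filterS _ (near_infty_natSinv_lt (PosNum eta0))) => n nN; exists n.
  by exists (tt n); split=> //; exact: lt_trans (ttn n) nN.
suff zr : z = rest.
  have [|t [tx ty]] := pick (ball rest e) e e0.
    by rewrite zr; exact: (nbhsx_ballx rest e e0).
  by exists t; split=> //; move: ty; rewrite ballEmdist /= metric_sym.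
apply: contrapT => /psi_leaves[T]; apply/negP; rewrite -ltNge.
(* Chosen so that two errors [eta] plus the distance [d] between the orbits just fail to reach
   [2^-1]. *)
pose eta := (2^-1 - d) / 2; have eta0 : 0 < eta by rewrite divr_gt0// subr_gt0.
have [r r0 rE] : exists2 r, 0 < r &
    forall w, mdist w rest < r -> mdist (psi T w) rest < eta.
  have /cvg_ballP/(_ _ eta0)/nbhs_ballP[r r0 rE] := @psi_continuous T rest.
  exists r => // w; rewrite metric_sym => wr; have := rE w.
  rewrite !ballEmdist /= psi_rest (metric_sym rest) (metric_sym rest).
  by apply; rewrite metric_sym.
have [t [tx ty]] := pick (psi T @^-1` ball (psi T z) eta) r r0
  (@psi_continuous T z _ (nbhsx_ballx _ _ eta0)).
move: ty; rewrite ballEmdist /= => ty; have {}tx := rE _ tx.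
have := xyd (T + t); rewrite !(flowD psi_flow).
have := metric_triangle (psi T z) (psi T (psi t y)) rest.
have := metric_triangle (psi T (psi t y)) (psi T (psi t x)) rest.
rewrite [mdist (psi T (psi t y)) (psi T (psi t x))]metric_sym.
have : eta + eta = 2^-1 - d by rewrite /eta; lra.
lra.
Qed.

End TimeChange.

Section WeaklyExpansive.
Context {R : realType} (psi : R -> torus R -> torus R).
Hypothesis psi_flow : continuous_flow psi.
Hypothesis psi_change : time_change psi (@torus_flow R).
Implicit Types (X Y : R * R) (x y z : torus R) (s t u e d : R).

(** Otherwise [|f|] takes the value [d], where it agrees with the distance to the integers. This
    keeps lifts of close orbits close in the plane. *)
Lemma zdist_small_continuous (f : R -> R) d : continuous f -> d <= 2^-1 ->
  `|f 0| < d -> (forall t, zdist (f t) < d) -> forall t, `|f t| < d.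
Proof.
move=> fc d2 f0 fd t; rewrite ltNge; apply/negP => dt.
have [||r rd] := @continuous_IVT R (fun t => `|f t|) 0 t d.
- by move=> u; apply: (cvg_norm (fc u)).
- by rewrite (ltW f0).
by have := fd r; rewrite zdist_small rd ?ltxx.
Qed.

Lemma psi_aperiodic t z : t != 0 -> z <> rest -> psi t z <> z.
Proof.
move=> t0 /eqP; rewrite -{1}(trepK z); set X := trep z => X0.
have [a [_ a0 aE am _]] := progress_ex psi_change X.
rewrite -(trepK z) -/X aE -{2}(leaf0 X) => /congruent_tproj/congruent_leaf_inj.
rewrite -a0 => /(inc_inj (le_mono (am X0))); exact/eqP.
Qed.

Lemma psi_displacement t : t != 0 -> exists2 m : R, 0 < m &
  forall z, 2^-1 <= mdist z rest -> m <= mdist z (psi t z).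
Proof.
move=> t0; pose C : set (torus R) := [set z | 2^-1 <= mdist z rest].
apply: (@compact_displacement R _ C).
- apply: (subclosed_compact _ torus_compact) => //.
  have distc : continuous (fun z : torus R => mdist z rest).
    by apply: mdist_continuous => z; [exact: cvg_id|exact: cst_continuous].
  by apply: preimage_closed (@closed_ge R 2^-1) => z _; exact: distc.
- exact: (psi_continuous psi_flow).
- move=> z Cz; apply: psi_aperiodic => // zr.
  by move: Cz; rewrite /C /= zr mdistxx leNgt invr_gt0 ltr0n.
Qed.

(** If the orbit of [X] does not reach parameter [c], then [rest] lies between the two points. The
    orbit of [X] still runs back to parameter -1, and its companion, following within [d], would
    have to cross [rest]. *)
Lemma same_leaf_same_orbit X a b c d : tproj X != rest ->
  tproj (leaf X c) != rest -> is_progress psi X a -> is_progress psi (leaf X c) b ->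
  0 <= c < d -> d <= 4^-1 -> (forall t, `|c + b t - a t| < d) ->
  exists t, tproj (leaf X c) = psi t (tproj X).
Proof.
move=> X0 Y0 Xa Yb /andP[c0 cd] d4 close; have [_ _ aE _ _] := Xa.
have [[t atc]|nc] := pselect (exists t, a t = c).
  by exists t; rewrite aE atc.
have [[l /andP[l0 lc] Xl]|[l /andP[cl l0] _]] := progress_reach Xa X0 nc; last first.
  by move: (le_lt_trans cl l0); rewrite ltNge c0.
have [H|H] := progress_one_sided Xa X0; first by case: nc; apply: H.
have [t at1] : exists t, a t = -1 by apply: H; rewrite oppr_le0.
have [bc b0 _ _ _] := Yb.
have [r br] : exists r, b r = l - c.
  apply: (@continuous_IVT _ b t 0) => //; rewrite b0.
  have := close t; rewrite at1 ltr_norml => /andP[? ?].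
  by apply/andP; split; lra.
have Yl : speed (leaf X c) (l - c) = 0 by rewrite speed_leaf addrC subrK.
by case: (progress_avoids psi_flow psi_change Yb Y0 Yl br).
Qed.

(* With [D] the difference of the two lifted orbits, the invariant
   [D.2 - slope * D.1] is transverse to the leaves. *)
Lemma shadowing_same_leaf X Y a b d : is_progress psi X a -> is_progress psi Y b ->
  d <= 4^-1 -> `|Y.1 - X.1| < d -> `|Y.2 - X.2| < d ->
  (forall t, mdist (psi t (tproj X)) (psi t (tproj Y)) < d) ->
  Y = leaf X (Y.1 - X.1) /\ forall t, `|Y.1 - X.1 + b t - a t| < d.
Proof.
move=> [ac a0 aE _ _] [bc b0 bE _ _] d4 XY1 XY2 close.
pose D1 t := Y.1 - X.1 + b t - a t.
pose D2 t := Y.2 - X.2 + slope * (b t - a t).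
have dist_leaf t : mdist (psi t (tproj X)) (psi t (tproj Y)) =
    Num.max (zdist (D1 t)) (zdist (D2 t)).
  rewrite aE bE mdist_tproj tdist_sym /tdist /leaf /=.
  congr (Num.max (zdist _) (zdist _)).
    by rewrite /D1; ring.
  by rewrite /D2; ring.
have d2 : d <= 2^-1 by lra.
have D1d t : `|D1 t| < d.
  apply: zdist_small_continuous => // [u||u].
  - by apply: cvgB; [apply: cvgD; [exact: cvg_cst|exact: bc]|exact: ac].
  - by rewrite /D1 a0 b0 subr0 addr0.
  - by have := close u; rewrite dist_leaf gt_max => /andP[].
have D2d t : `|D2 t| < d.
  apply: zdist_small_continuous => // [u||u].
  - apply: cvgD; first exact: cvg_cst.
    by apply: cvgMr; apply: cvgB; [exact: bc|exact: ac].
  - by rewrite /D2 a0 b0 subr0 mulr0 addr0.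
  - by have := close u; rewrite dist_leaf gt_max => /andP[].
split=> //; rewrite /leaf [LHS]surjective_pairing; congr pair; first by ring.
pose w := Y.2 - X.2 - slope * (Y.1 - X.1).
suff : `|w| <= 0 by rewrite normr_le0 /w => /eqP; lra.
apply/ler_addgt0Pl => e e0; rewrite addr0.
(* At a common visit within [e / 8] of [rest] both components of [D] are below [e / 4], so the
   constant [w] is below [3 * e / 4]. *)
have e8 : 0 < e / 8 by rewrite divr_gt0.
have d2' : d < 2^-1 by lra.
have [t [tx ty]] := psi_simultaneous psi_flow psi_change d2' close e8.
have : mdist (psi t (tproj X)) (psi t (tproj Y)) < e / 4.
  apply: le_lt_trans (metric_triangle _ rest _) _.
  by rewrite [mdist rest _]metric_sym; lra.
rewrite dist_leaf gt_max.
rewrite !zdist_small ?(le_trans (ltW (D1d t)))// ?(le_trans (ltW (D2d t)))//.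
move=> /andP[H1 H2].
have -> : w = D2 t - slope * D1 t by rewrite /w /D1 /D2; ring.
have /andP[s1 s2] := @slope_bounds R.
have H3 : `|slope * D1 t| <= 2 * `|D1 t|.
  by rewrite normrM ler_wpM2r// ger0_norm; lra.
by have := ler_normB (D2 t) (slope * D1 t); lra.
Qed.

Lemma psi_kinematic_expansive : kinematic_expansive psi.
Proof.
move=> e e0.
have e_neq0 : e != 0 by rewrite gt_eqF.
have [m m0 mP] := psi_displacement e_neq0.
have [m' m'0 m'P] : exists2 m : R, 0 < m &
    forall z, 2^-1 <= mdist z rest -> m <= mdist z (psi (- e) z).
  by apply: psi_displacement; rewrite oppr_eq0.
(* Torus distance along a leaf is at most twice the parameter difference, hence the halves of the
   displacement bounds. *)
pose d := Num.min 4^-1 (Num.min (m / 2) (m' / 2)).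
have d0 : 0 < d by rewrite !lt_min !divr_gt0// invr_gt0 ltr0n.
have d4 : d <= 4^-1 by rewrite ge_min lexx.
have dm : d <= m / 2 by rewrite !ge_min lexx orbT.
have dm' : d <= m' / 2 by rewrite !ge_min lexx !orbT.
have fixed z : (forall t, mdist rest (psi t z) < d) -> z = rest.
  move=> H; apply: contrapT => /(psi_leaves psi_change)[t].
  by have := H t; rewrite metric_sym; lra.
exists d => // x y xyd.
have [xr|/eqP xr] := pselect (x = rest).
  exists 0; first by rewrite oppr_lt0 e0.
  rewrite (flow0 psi_flow) xr; apply: fixed => t.
  by have := xyd t; rewrite xr (psi_rest psi_change).
have yr : y != rest.
  apply: contra xr => /eqP yr; apply/eqP; apply: fixed => t.
  by have := xyd t; rewrite yr (psi_rest psi_change) metric_sym.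
have := xyd 0; rewrite !(flow0 psi_flow) => xy0.
move: xr xyd xy0; rewrite -(trepK x); set X := trep x => X0 xyd xy0.
have [Y [Yy Y1 Y2]] := lift_near X y.
have [a Xa] := progress_ex psi_change X; have [b Yb] := progress_ex psi_change Y.
have {}Y1 := le_lt_trans Y1 xy0; have {}Y2 := le_lt_trans Y2 xy0.
rewrite -Yy in xyd yr *.
have [YX close] := shadowing_same_leaf Xa Yb d4 Y1 Y2 xyd.
set c := Y.1 - X.1 in Y1 YX close.
have [tau ytau] : exists tau, tproj Y = psi tau (tproj X).
  have [c0|/ltW c0] := leP 0 c.
    rewrite YX; rewrite YX in yr Yb.
    apply: (same_leaf_same_orbit X0 yr Xa Yb _ d4 close).
    by rewrite c0 -(ger0_norm c0).
  (* When [Y] lies behind [X] on the leaf, the two points exchange roles. *)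
  have XY : X = leaf Y (- c) by rewrite YX leafD subrr leaf0.
  have [t tX] : exists t, tproj (leaf Y (- c)) = psi t (tproj Y).
    rewrite XY in X0 Xa; apply: (same_leaf_same_orbit yr X0 Yb Xa _ d4).
      by rewrite oppr_ge0 c0 -(ler0_norm c0).
    move=> t; rewrite -normrN; have := close t.
    by congr (`|_| < _); ring.
  by exists (- t); rewrite XY tX (psiK psi_flow).
exists tau => //.
have [_ _ aE am _] := Xa; have [_ _ bE _ _] := Yb.
have amono := ltW_homo (am X0).
(* The lifted orbit of [Y] is that of [X] delayed by [tau]. At a time when [X] is far from [rest], a
   shift by [e] either way moves its parameter by at least [d], so closeness and monotonicity force
   [tau] between [- e] and [e]. *)
have bE' t : c + b t = a (t + tau).
  apply: (@congruent_leaf_inj _ X); apply: congruent_tproj.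
  by rewrite -leafD -YX -bE -aE ytau (flowD psi_flow).
have [t tfar] : exists t, 2^-1 <= mdist (psi t (tproj X)) rest.
  by apply: (psi_leaves psi_change); exact/eqP.
have moved u n : n <= mdist (psi t (tproj X)) (psi u (psi t (tproj X))) ->
    n <= 2 * `|a t - a (u + t)|.
  rewrite -(flowD psi_flow) !aE mdist_tproj => /le_trans; apply.
  by have := @tdist_leaf R X X (a t) (a (u + t)) 0; rewrite !subrr normr0 add0r; apply.
have := close t; rewrite bE' ltr_norml => /andP[l1 l2].
have {mP} := moved _ _ (mP _ tfar); have {m'P} := moved _ _ (m'P _ tfar).
have a1 : a (- e + t) <= a t by apply: amono; lra.
have a2 : a t <= a (e + t) by apply: amono; lra.
rewrite [`|a t - a (e + t)|]distrC !ger0_norm ?subr_ge0// => n1 n2.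
apply/andP; split; rewrite ltNge; apply/negP => tau_e.
  by have : a (t + tau) <= a (- e + t) by [apply: amono; lra]; lra.
by have : a (e + t) <= a (t + tau) by [apply: amono; lra]; lra.
Qed.

End WeaklyExpansive.

Theorem theorem3p10 (R : realType) :
  exists (M : metricType R) (phi : R -> M -> M),
    [/\ compact [set: M], continuous_flow phi,
        weakly_expansive phi & ~ expansive phi].
Proof.
exists (torus R), (@torus_flow R); split.
- exact: torus_compact.
- exact: torus_flow_flow.
- by move=> psi psi_flow psi_change; exact: psi_kinematic_expansive.
- exact: torus_flow_not_expansive.
Qed.
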